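(* Let $n\ge2$. For the cluster structure $\mathcal C_{CG}(n)$ on $GL_n$ (three stable variables, see context), the global toric action of $(\mathbb{C}^* )^3$ is generated by multiplication of $X\in GL_n$ by scalars and the action of $(\mathbb{C}^* )^2$ given by $(t_1,t_2)(X)=t_1^{D_n}Xt_2^{D_n}$, where $D_n=\mathrm{diag}(1,2,\dots,n)$ and $t^{D}=\mathrm{diag}(t^{d_1},\dots,t^{d_m})$ for $D=\mathrm{diag}(d_1,\dots,d_m)$. The rank of this action equals $3$.
   Context: Notation: $[a,b]=\{a,\dots,b\}$, $[m]=[1,m]$; $A_I^J$ is the submatrix with rows $I$ and columns $J$. Initial seed. Let $k=\lfloor\frac{n+1}2\rfloor$, $N=k(n-1)$, $M=N$ for $n$ even, $M=N-n+1$ for $n$ odd. Put $\mathcal X=[X_{[2,n]}\ 0]$, $\mathcal Y=[0\ Y_{[1,n-1]}]$ ($(n-1)\times(n+1)$ matrices) and let $U(X,Y)$ be the $k\times(k+1)$ block matrix whose $i$th block row has $\mathcal Y$ in block column $i$, $\mathcal X$ in block column $i+1$, and zeros elsewhere. Define $\theta_i(X)=\det X_{[n-i+1,n]}^{[n-i+1,n]}$, $i\in[n]$; $\varphi_i(X)=\det U(X,X)_{[N-i+1,N]}^{[k(n+1)-i+1,k(n+1)]}$, $i\in[N]$; $\psi_i(X)=\det U(X,X)_{[N-i+1,N]}^{[k(n+1)-i+2,k(n+1)+1]}$, $i\in[M]$. Each of these $n^2$ functions is attached to the vertex $(i,j)\in[n]\times[n]$ such that the upper left entry of the submatrix of $U(X,X)$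 (or of $X$, for $\theta$) defining it is $x_{ij}$ (a bijection). Stable (frozen) variables: $\theta_n=\det X,\varphi_N,\psi_M$. Quiver $Q_{CG}(n)$. Vertices: $[n]\times[n]$. Arrows: $(i,j+1)\to(i,j)$ for $i\in[n]$, $j\in[n-1]$ except $(i,j)=(1,n-1)$; $(i+1,j)\to(i,j)$ for $i\in[n-1]$, $j\in[n]$ except $(i,j)=(1,1)$; $(i,j)\to(i+1,j+1)$ for $i,j\in[n-1]$; $(n,j)\to(1,j)$ and $(1,j)\to(n,j+1)$ for $j\in[2,n-1]$; $(i,n)\to(i+2,1)$ and $(i+2,1)\to(i+1,n)$ for $i\in[1,n-2]$. $\mathcal C_{CG}(n)$ is the set of seeds obtained by iterated mutations with exchange relations $x_vx_v'=\prod_{v\to u}x_u+\prod_{u\to v}x_u$. Toric actions. A local toric action of rank $s$ at an extended cluster is $x_i\mapsto x_i\prod_{a=1}^{s}d_a^{w_{ia}}$, $d\in(\mathbb{C}^* )^s$, with integer weight matrix $(w_{ia})$ of rank $s$; it is global if at every extended cluster the induced action is again of this form, i.e. every cluster variable is multiplied by a monomial in the $d_a$. The proposition asserts that the action $X\mapsto t_0\,t_1^{D_n}Xt_2^{D_n}$, $(t_0,t_1,t_2)\in(\mathbb{C}^* )^3$, induces such a global toric action on the field of rational functions, of rank $3$ (the maximal rank, equal to the number of stable variables). *)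

(* Defs.v *)
From HB Require Import structures.
From mathcomp Require Import all_boot all_order all_algebra fraction.
From mathcomp Require Import mpoly.
From mathcomp Require Import reals.
From mathcomp Require Import complex.

Set Implicit Arguments.
Unset Strict Implicit.
Unset Printing Implicit Defensive.

Import GRing.Theory Num.Theory.
Local Open Scope ring_scope.
Local Open Scope quotient_scope.
Local Notation tofrac := (@FracField.tofrac _).

(* [quiver S u w] is the number of arrows u -> w. *)
Record seed (V : finType) (K : fieldType) := Seed {
  cluster : V -> K;
  quiver : V -> V -> nat
}.

Section ClusterStructure.
Variables (V : finType) (K : fieldType).

(* Add an arrow u -> w for every path u -> v -> w, reverse the arrows at v,
   and cancel 2-cycles: the last step is the truncated difference. *)
Definition mutate_quiver (v : V) (q : V -> V -> nat) (u w : V) : nat :=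
  let q' a b := if (a == v) || (b == v) then q b a
                else (q a b + q a v * q v b)%N in
  (q' u w - q' w u)%N.

Definition mutate_cluster (v : V) (q : V -> V -> nat) (x : V -> K) (u : V) : K :=
  if u == v then
    (\prod_w x w ^+ q v w + \prod_w x w ^+ q w v) / x v
  else x u.

Definition mutate (v : V) (S : seed V K) : seed V K :=
  Seed (mutate_cluster v (quiver S) (cluster S)) (mutate_quiver v (quiver S)).

Inductive cluster_structure (stable : {set V}) (S0 : seed V K) : seed V K -> Prop :=
| initial_seed : cluster_structure stable S0 S0
| mutated_seed (S : seed V K) (v : V) :
    cluster_structure stable S0 S -> v \notin stable ->
    cluster_structure stable S0 (mutate v S).

End ClusterStructure.

Section ToricActions.
Variables (V : finType) (F K : fieldType) (iota : F -> K).

Definition torus s (d : 'rV[F]_s) : Prop := forall a, d 0 a != 0.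

(* Action of the torus (F^* )^s on K by field automorphisms fixing F. *)
Definition torus_field_action s (act : 'rV[F]_s -> K -> K) : Prop :=
  [/\ forall d, torus d ->
        [/\ zmod_morphism (act d), monoid_morphism (act d)
          & forall c, act d (iota c) = iota c],
      forall f, act (const_mx 1) f = f
    & forall d e, torus d -> torus e ->
        forall f, act (\row_a (d 0 a * e 0 a)) f = act d (act e f)].

Definition weight_mx s (W : V -> 'I_s -> int) : 'M[rat]_(#|{: V}|, s) :=
  \matrix_(p, a) (W (enum_val p) a)%:~R.

Definition local_toric_action s (act : 'rV[F]_s -> K -> K) (x : V -> K) : Prop :=
  exists W : V -> 'I_s -> int,
    \rank (weight_mx W) = s /\
    forall d, torus d -> forall v,
      act d (x v) = x v * iota (\prod_a d 0 a ^ W v a).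

(* Global toric action of rank s. *)
Definition global_toric_action (stable : {set V}) (S0 : seed V K)
    s (act : 'rV[F]_s -> K -> K) : Prop :=
  torus_field_action act /\
  forall S, cluster_structure stable S0 S -> local_toric_action act (cluster S).

End ToricActions.

Section Submatrices.
Variable A : nzRingType.

(* The entry of M in row i and column j, both counted from 1 (and 0 when
   i, j are not indices of M). *)
Definition ent m p (M : 'M[A]_(m, p)) (i j : nat) : A :=
  if (0 < i)%N && (0 < j)%N then
    match insub i.-1, insub j.-1 with
    | Some a, Some b => M a b
    | _, _ => 0
    end
  else 0.

(* M_[i, i + m' - 1]^[j, j + p' - 1] *)
Definition submat m p (M : 'M[A]_(m, p)) (i j m' p' : nat) : 'M[A]_(m', p') :=
  \matrix_(a, b) ent M (i + a) (j + b).

End Submatrices.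

Section CremmerGervaisMatrix.
Variables (A : nzRingType) (n : nat).

Definition CG_k : nat := n.+1./2.
Definition CG_N : nat := CG_k * n.-1.
Definition CG_M : nat := if odd n then (CG_N - n + 1)%N else CG_N.

Definition calX (X : 'M[A]_n) : 'M[A]_(n.-1, n + 1) :=
  row_mx (submat X 2 1 n.-1 n) 0.
Definition calY (Y : 'M[A]_n) : 'M[A]_(n.-1, 1 + n) :=
  row_mx 0 (submat Y 1 1 n.-1 n).

(* Quotient and remainder of the (0-based) indices by the size of a block give
   the position of the block and the position inside it. *)
Definition CG_U (X Y : 'M[A]_n) : 'M[A]_(CG_k * n.-1, CG_k.+1 * n.+1) :=
  \matrix_(r, c)
    let a := (r %/ n.-1)%N in let i := (r %% n.-1)%N.+1 in
    let b := (c %/ n.+1)%N in let j := (c %% n.+1)%N.+1 in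
    if b == a then ent (calY Y) i j
    else if b == a.+1 then ent (calX X) i j
    else 0.

End CremmerGervaisMatrix.

Inductive CG_kind := Theta | Phi | Psi.

(* Indices of the functions theta_i (i in [n]), phi_i (i in [N]) and
   psi_i (i in [M]); the ordinal of value i - 1 stands for i. *)
Definition CG_index (n : nat) : finType := ('I_n + 'I_(CG_N n) + 'I_(CG_M n))%type.

Definition CG_kind_of n (a : CG_index n) : CG_kind :=
  match a with
  | inl (inl _) => Theta
  | inl (inr _) => Phi
  | inr _ => Psi
  end.

Definition CG_ord n (a : CG_index n) : nat :=
  match a with
  | inl (inl i) => i
  | inl (inr i) => i
  | inr i => i
  end.

Section InitialSeed.
Variables (A : comNzRingType) (n : nat).

(* The submatrix of X or of U(X, X) whose determinant is theta_i, phi_i or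
   psi_i, where i = CG_ord a + 1. *)
Definition CG_submx (X : 'M[A]_n) (a : CG_index n) : 'M[A]_((CG_ord a).+1) :=
  let l := CG_ord a in
  let k := CG_k n in
  let N := CG_N n in
  match CG_kind_of a with
  | Theta => submat X (n - l) (n - l) l.+1 l.+1
  | Phi => submat (CG_U X X) (N - l) (k * n.+1 - l) l.+1 l.+1
  | Psi => submat (CG_U X X) (N - l) (k * n.+1 - l + 1) l.+1 l.+1
  end.

Definition CG_fun (X : 'M[A]_n) (a : CG_index n) : A := \det (CG_submx X a).

(* Upper left entry. *)
Definition CG_corner (X : 'M[A]_n) (a : CG_index n) : A := CG_submx X a ord0 ord0.

End InitialSeed.

(* theta_n, phi_N, psi_M *)
Definition CG_stable_index n (a : CG_index n) : bool :=
  match a with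
  | inl (inl i) => i.+1 == n
  | inl (inr i) => i.+1 == CG_N n
  | inr i => i.+1 == CG_M n
  end.

(* The field of rational functions on GL_n. *)
Notation CG_field R n := {fraction {mpoly R[i][(n * n)%N]}}.

Section CremmerGervais.
Variables (R : realType) (n : nat).

Local Notation CG_poly := {mpoly R[i][(n * n)%N]}.
Local Notation CG_field := (CG_field R n).

Definition CG_const (c : R[i]) : CG_field := tofrac c%:MP_[n * n].

Definition generic_mx : 'M[CG_poly]_n := \matrix_(i, j) 'X_(mxvec_index i j).

(* The vertex (i, j) of the quiver is the pair of ordinals (i - 1, j - 1). *)
Definition CG_vertex : finType := ('I_n * 'I_n)%type.

Definition attached (a : CG_index n) (v : CG_vertex) : bool :=
  CG_corner generic_mx a == generic_mx v.1 v.2.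

Definition CG_cluster (v : CG_vertex) : CG_field :=
  if [pick a | attached a v] is Some a then tofrac (CG_fun generic_mx a) else 0.

Definition CG_stable : {set CG_vertex} :=
  [set v | [exists a, CG_stable_index a && attached a v]].

(* Number of arrows u -> w of Q_CG(n); here vertices are numbered from 1. *)
Definition CG_arrows (u w : nat * nat) : nat :=
  let: (i, j) := u in let: (i', j') := w in
  ([&& i == i', j == j'.+1 & (i', j') != (1, n.-1)] +
   [&& i == i'.+1, j == j' & (i', j') != (1, 1)] +
   [&& i' == i.+1 & j' == j.+1] +
   [&& i == n, i' == 1, j' == j & 2 <= j <= n.-1] +
   [&& i == 1, i' == n, j' == j.+1 & 2 <= j <= n.-1] +
   [&& j == n, j' == 1 & i' == i.+2] +
   [&& j == 1, j' == n, i == i'.+1 & 2 <= i' <= n.-1])%N.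

Definition CG_quiver (u w : CG_vertex) : nat :=
  CG_arrows (u.1.+1, u.2.+1) (w.1.+1, w.2.+1).

Definition CG_seed : seed CG_vertex CG_field := Seed CG_cluster CG_quiver.

(* The substitution of h for the variables.  The formula does not depend on the
   chosen fraction as soon as the h_i are algebraically independent. *)
Definition pullback (h : (n * n).-tuple CG_poly) (f : CG_field) : CG_field :=
  tofrac (comp_mpoly h \n_(repr f)) / tofrac (comp_mpoly h \d_(repr f)).

(* t^D for D = diag(1, 2, ..., n) *)
Definition powD (A : comNzRingType) (t : A) : 'M[A]_n := diag_mx (\row_i t ^+ i.+1).

(* f |-> (X |-> f (t_0 t_1^D X t_2^D)) for t = (t_0, t_1, t_2) *)
Definition CG_action (t : 'rV[R[i]]_3) (f : CG_field) : CG_field :=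
  let c a : CG_poly := (t 0 a)%:MP in
  let Y := c 0 *: (powD (c 1) *m generic_mx *m powD (c 2%:R)) in
  pullback [tuple mxvec Y 0 p | p < n * n] f.

End CremmerGervais.

(* Main.v *)
From HB Require Import structures.
Require Import Defs.
From mathcomp Require Import fingroup perm.
From mathcomp Require Import all_boot all_order all_algebra fraction.
From mathcomp Require Import mpoly reals complex.
From mathcomp Require Import zify ring lra.

(** Call a weight matrix [W] balanced when, at every mutable vertex, the
    weights of the heads of the outgoing arrows and of the tails of the
    incoming arrows have the same sum. Then both monomials of each exchange
    relation are scaled by the same factor, so that the new variable is scaled
    by a monomial too. Balance and the rank of [W] survive a mutation, hence a
    balanced action on the initial seed is global
    ([balanced_global_toric_action]). Conversely the weights of a global action
    are balanced as soon as no nontrivial linear combination of two exchange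
    monomials vanishes ([global_action_balanced]). It remains to find the
    balanced weights.

    The entries of [U(X, X)] and of [X] next to an entry [x_ij] are again
    entries of [X], and this makes the set of the [x_ij] a piece of a
    triangular lattice: [diag] goes one step down the diagonal, [up] and [left]
    go up and left, and the three steps compose to the identity. The functions
    of the initial seed are the determinants of submatrices whose diagonals
    are the final segments of the maximal paths along [diag]: there are three
    such paths, which start at [x_11], [x_1n] and [x_21] and end at [x_nn],
    [x_(n-1)n] and [x_n1]. The arrows of the quiver are the steps [diag], and
    the steps [up] and [left] from the mutable vertices. For a function [f] on
    the vertices let [g p] be the difference of [f] at [p] and at the next
    place on the diagonal; then the defect of balance of [f] at a mutable
    vertex [p] is [g (up p) + g (left p) - g p - g (back p)], where [back] is
    the step inverse to [diag] ([quiver_defect]). The balance condition thus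
    says that [g i j] is an affine function of [i] and [j]
    ([affine_difference_eq0]): the balanced weights form a space of dimension
    3.

    The action multiplies [x_ij] by [t_0 t_1^i t_2^j]. A minor of [U(X, X)] is
    then multiplied by the product of these factors over its diagonal
    ([CG_fun_weight]), which means that [g] is [(1, i, j)]: this is the whole
    three-dimensional space.

    For the independence of the exchange monomials, each [x_ij] is replaced by
    [y_ij] times a power of a parameter. The exponents [cost_at] satisfy a
    strict Monge inequality on the band of nonzero entries of [U(X, X)]
    ([place_uncross]), hence the lowest term of a minor is the product of its
    diagonal ([det_lowest_term]). By [quiver_defect] again, applied to the
    indicator of one diagonal place, the products of diagonals that come from
    the two exchange monomials are different monomials in the [y_ij]
    ([exchange_free]). *)

Set Implicit Arguments.
Unset Strict Implicit.
Unset Printing Implicit Defensive.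

Import Order.TTheory GRing.Theory Num.Theory.
Local Open Scope ring_scope.

(** * Weights under mutation *)

Section QuasiHomogeneous.
Variables (V : finType) (F K : fieldType) (s : nat).
Implicit Types (d : 'rV[F]_s) (q : V -> V -> nat) (W : V -> 'I_s -> int).

Definition character d (w : 'I_s -> int) : F := \prod_a d 0 a ^ w a.

Lemma characterD d w1 w2 : torus d ->
  character d (fun a => w1 a + w2 a) = character d w1 * character d w2.
Proof.
by move=> td; rewrite -big_split; apply: eq_bigr => a _; exact/expfzDr/td.
Qed.

Lemma character_neq0 d w : torus d -> character d w != 0.
Proof. by move=> td; apply/prodf_neq0 => a _; exact/expfz_neq0/td. Qed.

Lemma character_sum d W (e : V -> nat) : torus d ->
  \prod_w character d (W w) ^+ e w = character d (fun a => \sum_w W w a *+ e w).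
Proof.
move=> td; under eq_bigr do rewrite -prodrXl.
rewrite exchange_big; apply: eq_bigr => a _ /=.
pose f k := d 0 a ^ k.
have fD : {morph f : x y / x + y >-> x * y} by move=> x y; exact/expfzDr/td.
rewrite -[RHS]/(f _) (big_morph f fD (expr0z _)).
by apply: eq_bigr => w _; rewrite /f -mulr_natr natz -exprz_exp.
Qed.

(** The rank condition in the form that is easy to transport along linear
    changes of the weights. *)
Lemma weight_rankP W :
  \rank (weight_mx W) = s <->
  forall c : 'I_s -> rat,
    (forall v, \sum_a (W v a)%:~R * c a = 0) -> forall a, c a = 0.
Proof.
split=> [rkW c Wc0 a | W_inj].
  have /row_fullP[B BW] : row_full (weight_mx W) by rewrite /row_full rkW.
  pose C : 'cV_s := \col_a c a.
  have WC0 : weight_mx W *m C = 0.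
    apply/colP => p; rewrite !mxE -[RHS](Wc0 (enum_val p)).
    by apply: eq_bigr => b _; rewrite !mxE.
  have : C = 0 by rewrite -[C]mul1mx -BW -mulmxA WC0 mulmx0.
  by move/colP/(_ a); rewrite !mxE.
have coker0 : cokermx (weight_mx W) = 0.
  apply/matrixP => a b; rewrite [RHS]mxE.
  apply: (W_inj (fun a => cokermx (weight_mx W) a b)) => v.
  have /matrixP/(_ (enum_rank v) b) := mulmx_coker (weight_mx W).
  rewrite [in RHS]mxE [in LHS]mxE => Wv0; rewrite -[RHS]Wv0.
  by apply: eq_bigr => c _; rewrite [weight_mx _ _ _]mxE enum_rankK.
have := mxrank_coker (weight_mx W); rewrite coker0 mxrank0.
by have := rank_leq_col (weight_mx W); lia.
Qed.

(** The linear condition on the weights under which both monomials of every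
    exchange relation are scaled alike. *)
Definition balanced (stable : {set V}) q W :=
  forall u, u \notin stable -> forall a,
    \sum_w W w a *+ q u w = \sum_w W w a *+ q w u.

Definition mutate_weight v q W (u : V) (a : 'I_s) : int :=
  if u == v then \sum_w W w a *+ q v w - W v a else W u a.

Lemma mutate_quiver_loopless v q :
  (forall u, q u u = 0%N) -> forall u, mutate_quiver v q u u = 0%N.
Proof. by move=> q0 u; rewrite /mutate_quiver subnn. Qed.

(** The balance condition depends only on the differences between opposite
    arrow counts. There the truncated subtraction of [mutate_quiver] becomes an
    honest one, and the effect of the mutation is polynomial. *)
Lemma mutate_quiver_skew v q u w :
  (mutate_quiver v q u w)%:Z - (mutate_quiver v q w u)%:Z =
  if (u == v) || (w == v) then (q w u)%:Z - (q u w)%:Z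
  else (q u w)%:Z - (q w u)%:Z + (q u v * q v w)%:Z - (q w v * q v u)%:Z.
Proof.
rewrite /mutate_quiver; case: (u == v); case: (w == v) => /=; lia.
Qed.

Lemma balancedP q W u a :
  (\sum_w W w a *+ q u w = \sum_w W w a *+ q w u) <->
  (\sum_w ((q u w)%:Z - (q w u)%:Z) * W w a = 0).
Proof.
have -> : \sum_w ((q u w)%:Z - (q w u)%:Z) * W w a =
    \sum_w W w a *+ q u w - \sum_w W w a *+ q w u.
  by rewrite -sumrB; apply: eq_bigr => w _; lia.
by split=> [-> | /eqP]; [rewrite subrr | rewrite subr_eq0 => /eqP].
Qed.

(** At [u != v], the paths through [v] add to the defect of balance a multiple
    of the common weight of the two exchange monomials at [v], and the reversal
    of the arrows between [u] and [v] together with the new weight of [v]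
    subtracts the same multiple. *)
Lemma balanced_mutate (stable : {set V}) v q W :
  v \notin stable -> (forall u, q u u = 0%N) -> balanced stable q W ->
  balanced stable (mutate_quiver v q) (mutate_weight v q W).
Proof.
move=> vS q0 bal u uS a; apply/balancedP.
under eq_bigr do rewrite mutate_quiver_skew /mutate_weight.
have /balancedP bu := bal u uS a; have /balancedP bv := bal v vS a.
have [->|uv] := eqVneq u v => /=.
  rewrite -[RHS]oppr0 -[in RHS]bv -sumrN; apply: eq_bigr => w _.
  by case: eqVneq => [->|_]; rewrite -mulNr opprB // subrr !mul0r.
rewrite (bigD1 v) //= eqxx.
under [X in _ + X]eq_bigr => w wv do rewrite (negbTE wv) !(mulrDl, mulNr).
rewrite !big_split /= !sumrN.
have sumv (f : V -> int) : \sum_(w | w != v) f w * W w a =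
    \sum_w f w * W w a - f v * W v a.
  by rewrite [\sum_w _](bigD1 v) //= addrAC subrr add0r.
rewrite !sumv !q0 !muln0 !mul0n !mul0r !subr0.
have -> : \sum_w (q u v * q v w)%:Z * W w a =
    (q u v)%:Z * \sum_w W w a *+ q v w.
  by rewrite mulr_sumr; apply: eq_bigr => w _; lia.
have -> : \sum_w (q w v * q v u)%:Z * W w a =
    (q v u)%:Z * \sum_w W w a *+ q v w.
  rewrite (bal v vS a) mulr_sumr; apply: eq_bigr => w _; lia.
have : \sum_w (q u w)%:Z * W w a - \sum_w (q w u)%:Z * W w a = 0.
  by rewrite -[RHS]bu -sumrB; apply: eq_bigr => w _; rewrite mulrBl.
by move=> /eqP; rewrite subr_eq0 => /eqP->; ring.
Qed.

(** The new weights come from the old ones by an invertible change: the weight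
    of [v] is subtracted from a combination of the others. *)
Lemma weight_rank_mutate v q W :
  (forall u, q u u = 0%N) -> \rank (weight_mx W) = s ->
  \rank (weight_mx (mutate_weight v q W)) = s.
Proof.
move=> q0 /weight_rankP W_inj; apply/weight_rankP => c Wc0; apply: W_inj.
have Wuc0 u : u != v -> \sum_a (W u a)%:~R * c a = 0.
  move=> /negbTE uv; rewrite -[RHS](Wc0 u); apply: eq_bigr => a _.
  by rewrite /mutate_weight uv.
move=> u; have [-> | /Wuc0 //] := eqVneq u v.
have := Wc0 v; rewrite /mutate_weight eqxx.
under eq_bigr do rewrite rmorphB mulrBl raddf_sum mulr_suml.
rewrite sumrB exchange_big big1 ?sub0r => [/eqP|w _]; first by rewrite oppr_eq0 => /eqP.
under eq_bigr do rewrite raddfMn mulrnAl.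
rewrite sumrMnl; have [->|/Wuc0->] := eqVneq w v; first by rewrite q0.
by rewrite mul0rn.
Qed.

Variable iota : {rmorphism F -> K}.

Section OneTorusElement.
Variables (g : {rmorphism K -> K}) (d : 'rV[F]_s).
Hypothesis td : torus d.

Lemma quasi_homogeneous_monomial x W (e : V -> nat) :
  (forall v, g (x v) = x v * iota (character d (W v))) ->
  g (\prod_w x w ^+ e w) = (\prod_w x w ^+ e w) *
    iota (character d (fun a => \sum_w W w a *+ e w)).
Proof.
move=> gx; rewrite rmorph_prod -character_sum // rmorph_prod -big_split.
by apply: eq_bigr => w _; rewrite rmorphXn gx exprMn rmorphXn.
Qed.

Lemma quasi_homogeneous_mutate (stable : {set V}) v q x W :
  v \notin stable -> balanced stable q W ->
  (forall v, g (x v) = x v * iota (character d (W v))) ->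
  forall u, g (mutate_cluster v q x u) =
    mutate_cluster v q x u * iota (character d (mutate_weight v q W u)).
Proof.
move=> vS bal gx u; rewrite /mutate_cluster /mutate_weight.
case: (eqVneq u v) => [_|_]; last exact: gx.
rewrite rmorphM fmorphV gx rmorphD !(quasi_homogeneous_monomial _ gx).
have <- : character d (fun a => \sum_w W w a *+ q v w) =
          character d (fun a => \sum_w W w a *+ q w v).
  by apply: eq_bigr => a _; rewrite bal.
rewrite -mulrDl (characterD _ (fun a => - W v a)) // rmorphM invfM.
have -> : character d (fun a => - W v a) = (character d (W v))^-1.
  by rewrite -prodfV; apply: eq_bigr => a _; rewrite invr_expz.
by rewrite fmorphV; ring.
Qed.

End OneTorusElement.

Lemma torus_field_action_rmorphism (act : 'rV[F]_s -> K -> K) d :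
  torus_field_action iota act -> torus d ->
  exists g : {rmorphism K -> K}, act d = g.
Proof.
move=> [act_hom _ _] td; have [aA aM _] := act_hom d td.
pose g : {rmorphism K -> K} := HB.pack (act d)
  (GRing.isZmodMorphism.Build _ _ (act d) aA)
  (GRing.isMonoidMorphism.Build _ _ (act d) aM).
by exists g.
Qed.

(** Induction along the mutations, carrying a balanced weight matrix of full
    rank for the current cluster. *)
Lemma balanced_global_toric_action (stable : {set V}) (S0 : seed V K)
    (act : 'rV[F]_s -> K -> K) W :
  torus_field_action iota act -> (forall u, quiver S0 u u = 0%N) ->
  \rank (weight_mx W) = s -> balanced stable (quiver S0) W ->
  (forall d, torus d -> forall v,
     act d (cluster S0 v) = cluster S0 v * iota (character d (W v))) ->
  global_toric_action iota stable S0 act.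
Proof.
move=> Hact q0 rkW balW homW; split=> // S S_mut.
suff [W' [rkW' _ _ homW']] : exists W', [/\ \rank (weight_mx W') = s,
    forall u, quiver S u u = 0%N, balanced stable (quiver S) W' &
    forall d, torus d -> forall v,
      act d (cluster S v) = cluster S v * iota (character d (W' v))].
  by exists W'.
elim: S_mut => [|{}S v _ [W' [rkW' q0' balW' homW']] vS]; first by exists W.
exists (mutate_weight v (quiver S) W'); split=> [||| d td u].
- exact: weight_rank_mutate.
- exact: mutate_quiver_loopless.
- exact: balanced_mutate.
have [g gE] := torus_field_action_rmorphism Hact td; rewrite gE.
by apply: (quasi_homogeneous_mutate td vS balW') => w; rewrite -gE homW'.
Qed.

End QuasiHomogeneous.

(** * The quiver as a triangular lattice *)

(* Splits along the boundary tests of the goal, keeping only the consistent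
   cases. *)
Ltac boundary_cases := repeat (case: ifP => ? /=; try lia).

(* Decides a balance equation, where the entries [e p] outside of the matrix
   vanish by [h]. *)
Ltac balance_cases e h :=
  boundary_cases;
  repeat match goal with |- context [e ?p] =>
    let ep0 := fresh in
    have ep0 : e p = 0 by [apply: h => /=; lia]; rewrite ep0 end;
  try lia.

(* Compares the condition of a family of arrows with its explicit form. *)
Ltac arrow_cases := move=> k l; rewrite /= !xpair_eqE; lia.

Section VertexLattice.
Variable n : nat.
Hypothesis hn : (2 <= n)%N.
Local Notation V := ('I_n * 'I_n)%type.

Definition vplace (v : V) : nat * nat := (v.1.+1, v.2.+1).

Definition in_square (p : nat * nat) : bool :=
  [&& 0 < p.1 <= n & 0 < p.2 <= n]%N.

(** The upper left entries of the three stable minors. *)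
Definition in_corner (p : nat * nat) : bool :=
  [|| p == (1, 1), p == (1, n) | p == (2, 1)]%N.

(** The places of the entries of [X] that surround [x_ij] in [U(X, X)]. Each
    step that leaves [X] continues in the neighbouring block, which contains
    [X] again, shifted by one row or by one column. [diag] sends the last place
    of a diagonal to [(0, 0)], where every matrix has the entry 0. *)
Definition up (p : nat * nat) : nat * nat :=
  (if p.1 == 1 then (n, p.2.+1) else (p.1.-1, p.2))%N.

Definition left (p : nat * nat) : nat * nat :=
  (if p.2 == 1 then (p.1.-1, n) else (p.1, p.2.-1))%N.

Definition back (p : nat * nat) : nat * nat :=
  (if p.1 == 1 then (n, p.2)
   else if p.2 == 1 then (p.1.-2, n) else (p.1.-1, p.2.-1))%N.

Definition diag (p : nat * nat) : nat * nat :=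
  (if (p.1 < n) && (p.2 < n) then (p.1.+1, p.2.+1)
   else if (p.1 == n) && (1 < p.2 < n) then (1, p.2)
   else if (p.2 == n) && (p.1.+2 <= n) then (p.1.+2, 1)
   else (0, 0))%N.

Definition entp (A : nzRingType) (M : 'M[A]_n) (p : nat * nat) : A :=
  ent M p.1 p.2.

Lemma ent_vplace (A : nzRingType) (M : 'M[A]_n) (v : V) :
  entp M (vplace v) = M v.1 v.2.
Proof. by case: v => i j; rewrite /entp /ent /= !valK. Qed.

Lemma ent_out (A : nzRingType) (M : 'M[A]_n) p : ~~ in_square p -> entp M p = 0.
Proof.
case: p => i j; rewrite /entp /ent /in_square /=; case: i => [|i]; case: j => [|j] //=.
by do 2![case: insubP => //= ? -> _].
Qed.

Lemma vertex_ex p : in_square p -> exists v, vplace v = p.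
Proof.
case: p => [[|i] [|j]]; rewrite /in_square ?andbF //= => /andP[hi hj].
by exists (Ordinal hi, Ordinal hj).
Qed.

Lemma vplace_inj : injective vplace.
Proof. by case=> i j [i' j'] [/ord_inj-> /ord_inj->]. Qed.

Lemma in_square_vplace v : in_square (vplace v).
Proof. by case: v => i j; rewrite /in_square /= !ltn_ord. Qed.

(** Each of the seven families of arrows has, at a given vertex, at most one
    outgoing and one incoming arrow; [p] is its other end. *)
Lemma sum_family (M : 'M[int]_n) (b : bool) (p : nat * nat) (c : V -> bool) :
  (forall w, c w = b && (vplace w == p)) ->
  \sum_w M w.1 w.2 *+ c w = if b then entp M p else 0.
Proof.
move=> cE; under eq_bigr do rewrite cE.
case: b {cE} => /=; last by rewrite big1.
have [/vertex_ex[v <-]|pP] := boolP (in_square p); last first.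
  rewrite ent_out // big1 // => w _; case: eqP => // wp.
  by case/negP: pP; rewrite -wp in_square_vplace.
rewrite (bigD1 v) //= eqxx ent_vplace big1 ?addr0 // => w.
by rewrite (inj_eq vplace_inj) => /negbTE->.
Qed.

Definition diff (A : nzRingType) (M : 'M[A]_n) p : A := entp M p - entp M (diag p).

(** A mutable vertex [p] has the outgoing arrows to [up p], [left p] and
    [diag p], and the incoming arrows from [back p], [diag (left p)] and
    [diag (up p)], as far as these places exist. Pairing [up p] with
    [diag (up p)], [left p] with [diag (left p)], and [diag p] and [back p]
    with two opposite copies of [p], leaves differences along the diagonals. *)
Lemma quiver_defect (M : 'M[int]_n) (v : V) : ~~ in_corner (vplace v) ->
  \sum_w M w.1 w.2 *+ CG_quiver v w - \sum_w M w.1 w.2 *+ CG_quiver w v =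
  diff M (up (vplace v)) + diff M (left (vplace v))
    - diff M (vplace v) - diff M (back (vplace v)).
Proof.
move=> vC.
rewrite /CG_quiver /CG_arrows; case: v vC => [vi vj] vC /=.
under eq_bigr do rewrite !mulrnDr.
under [X in _ - X]eq_bigr do rewrite !mulrnDr.
rewrite !big_split /=.
move: vC; rewrite /vplace /in_corner !xpair_eqE.
set i := (vi : nat).+1; set j := (vj : nat).+1 => /= vC.
have hij : (0 < i <= n)%N && (0 < j <= n)%N := in_square_vplace (vi, vj).
have fam b p c :
    (forall k l : 'I_n, c (k, l) = b && ((k.+1, l.+1) == p)) ->
    \sum_w M w.1 w.2 *+ c w = if b then entp M p else 0.
  by move=> cE; apply: sum_family; case.
(* First the seven families of arrows out of [v], then those into [v]. *)
rewrite (fam ((1 < j) && ~~ ((i == 1) && (j == n)))%N (i, j.-1)%N); last by arrow_cases.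
rewrite (fam ((1 < i) && ~~ ((i == 2) && (j == 1)))%N (i.-1, j)%N); last by arrow_cases.
rewrite (fam true (i.+1, j.+1)%N); last by arrow_cases.
rewrite (fam ((i == n) && (1 < j < n))%N (1, j)%N); last by arrow_cases.
rewrite (fam ((i == 1) && (1 < j < n))%N (n, j.+1)%N); last by arrow_cases.
rewrite (fam (j == n)%N (i.+2, 1)%N); last by arrow_cases.
rewrite (fam ((j == 1) && (2 < i))%N (i.-1, n)%N); last by arrow_cases.
rewrite (fam (~~ ((i == 1) && (j == n.-1)))%N (i, j.+1)%N); last by arrow_cases.
rewrite (fam (~~ ((i == 1) && (j == 1)))%N (i.+1, j)%N); last by arrow_cases.
rewrite (fam true (i.-1, j.-1)%N); last by arrow_cases.
rewrite (fam ((i == 1) && (1 < j < n))%N (n, j)%N); last by arrow_cases.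
rewrite (fam ((i == n) && (2 < j))%N (1, j.-1)%N); last by arrow_cases.
rewrite (fam ((j == 1) && (2 < i))%N (i.-2, n)%N); last by arrow_cases.
rewrite (fam ((j == n) && (1 < i < n))%N (i.+1, 1)%N); last by arrow_cases.
rewrite /diff.
have := @ent_out _ M; move: (entp M) => e; rewrite /in_square.
clear fam; clearbody i j; clear vi vj M.
have [m nE] : exists m, n = m.+2 by exists n.-2; lia.
rewrite /up /left /back /diag /= nE; rewrite nE in vC hij.
move=> /= hout.
have [i1|i1] := eqVneq i 1%N; last have [j1|j1] := eqVneq j 1%N.
- have [j' jE] : exists j', j = j'.+2 by exists j.-2; lia.
  subst i j; rewrite /=; rewrite /= in vC hij; balance_cases e hout.
- have [i' iE] : exists i', i = i'.+3 by exists i.-1.-2; lia.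
  subst i j; rewrite /=; rewrite /= in vC hij; balance_cases e hout.
have [i' iE] : exists i', i = i'.+2 by exists i.-2; lia.
have [j' jE] : exists j', j = j'.+2 by exists j.-2; lia.
subst i j; rewrite /=; rewrite /= in vC hij; balance_cases e hout.
Qed.

Lemma diff_lincomb s (M : 'I_s -> 'M[int]_n) (c : 'I_s -> rat) p :
  diff (\matrix_(i, j) \sum_a (M a i j)%:~R * c a) p =
  \sum_a (diff (M a) p)%:~R * c a.
Proof.
set Mc := \matrix_(i, j) _.
have McE q : entp Mc q = \sum_a (entp (M a) q)%:~R * c a.
  have [/vertex_ex[v <-]|q_out] := boolP (in_square q).
    by rewrite ent_vplace mxE; apply: eq_bigr => a _; rewrite ent_vplace.
  by rewrite ent_out // big1 // => a _; rewrite ent_out // mul0r.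
rewrite /diff !McE -sumrB; apply: eq_bigr => a _.
by rewrite rmorphB mulrBl.
Qed.

Lemma up_square p : in_square p -> ~~ in_corner p -> in_square (up p).
Proof.
case: p => i j; rewrite /in_square /in_corner /up /= !xpair_eqE => hp hc.
by boundary_cases.
Qed.

Lemma left_square p : in_square p -> ~~ in_corner p -> in_square (left p).
Proof.
case: p => i j; rewrite /in_square /in_corner /left /= !xpair_eqE => hp hc.
by boundary_cases.
Qed.

Lemma back_square p : in_square p -> ~~ in_corner p -> in_square (back p).
Proof.
case: p => i j; rewrite /in_square /in_corner /back /= !xpair_eqE => hp hc.
by boundary_cases.
Qed.

(** The affine functions satisfy the balance equation. *)
Lemma parallelogram p : in_square p -> ~~ in_corner p ->
  ((up p).1 + (left p).1 = p.1 + (back p).1)%N /\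
  ((up p).2 + (left p).2 = p.2 + (back p).2)%N.
Proof.
case: p => i j; rewrite /in_square /in_corner /up /left /back /= !xpair_eqE => hp hc.
by boundary_cases.
Qed.

Lemma neighbours_neq p : in_square p -> ~~ in_corner p ->
  [&& up p != p, left p != p & back p != p].
Proof.
case: p => i j; rewrite /in_square /in_corner /up /left /back /= !xpair_eqE => hp hc.
by boundary_cases; rewrite !xpair_eqE; lia.
Qed.

Lemma CG_quiver_loopless (v : V) : CG_quiver v v = 0%N.
Proof.
rewrite /CG_quiver /CG_arrows !xpair_eqE.
by have := ltn_ord v.1; have := ltn_ord v.2; lia.
Qed.

End VertexLattice.

(** * The diagonals of the initial minors *)

Arguments CG_k : simpl never.
Arguments CG_N : simpl never.
Arguments CG_M : simpl never.

Section MinorPlaces.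
Variable n : nat.
Hypothesis hn : (2 <= n)%N.
Local Notation V := ('I_n * 'I_n)%type.
Local Notation k := (CG_k n).
Local Notation N := (CG_N n).

(** Position in [X] of the entry of a block row of [U(X, X)] in the row [i] and
    the column [x], counted from 0 from the start of the block row;
    [(0, 0)] stands for a zero of [U(X, X)]. *)
Definition band (i x : nat) : nat * nat :=
  (if 0 < x <= n then (i.+1, x)
   else if n < x <= n.*2 then (i.+2, x - n) else (0, 0))%N.

(** Rows and columns are counted from 0, in [X] for [Theta] and in [U(X, X)]
    otherwise. *)
Definition place (K : CG_kind) (r c : nat) : nat * nat :=
  if K is Theta then (r.+1, c.+1)
  else band (r %% n.-1) (c - (r %/ n.-1) * n.+1).

Definition row_end (K : CG_kind) : nat := if K is Theta then n else N.

Definition col_end (K : CG_kind) : nat :=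
  match K with Theta => n | Phi => k * n.+1 | Psi => (k * n.+1).+1 end.

Definition chain_length (K : CG_kind) : nat :=
  match K with Theta => n | Phi => N | Psi => CG_M n end.

(** The minors of one kind have the same lower right corner, so their diagonals
    are the initial segments of one sequence when counted from that corner. *)
Definition chain (K : CG_kind) (m : nat) : nat * nat :=
  place K (row_end K - m.+1) (col_end K - m.+1).

Definition pos (a : CG_index n) : nat * nat := chain (CG_kind_of a) (CG_ord a).

Lemma CG_k_half : (k.*2 = if odd n then n.+1 else n)%N.
Proof. by rewrite /CG_k; case: ifP; lia. Qed.

Lemma CG_M_le : (CG_M n <= N)%N.
Proof.
rewrite /CG_M /CG_N; case: ifP => // _.
have := CG_k_half; case: (k) => [|k']; first by case: ifP; lia.
by move=> _; rewrite mulSn; move: (k' * _)%N => X; lia.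
Qed.

Lemma chain_length_le K : (chain_length K <= row_end K)%N.
Proof. by case: K => //=; exact: CG_M_le. Qed.

Lemma ord_lt_chain (a : CG_index n) : (CG_ord a < chain_length (CG_kind_of a))%N.
Proof. by case: a => [[i|i]|i]; exact: ltn_ord. Qed.

Lemma ent_ord (A : nzRingType) m p (M : 'M[A]_(m, p)) i j
    (hi : (i < m)%N) (hj : (j < p)%N) :
  ent M i.+1 j.+1 = M (Ordinal hi) (Ordinal hj).
Proof.
by rewrite /ent /= (insubT (fun x => x < m)%N hi) (insubT (fun x => x < p)%N hj).
Qed.

Lemma CG_U_ent (A : nzRingType) (X : 'M[A]_n) r c :
  (r < k * n.-1)%N -> (c < k.+1 * n.+1)%N ->
  ent (CG_U X X) r.+1 c.+1 = entp X (place Phi r c).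
Proof.
move=> hr hc; rewrite ent_ord mxE /= /place.
have r_eq := divn_eq r n.-1; have c_eq := divn_eq c n.+1.
have hi : (r %% n.-1 < n.-1)%N by rewrite ltn_mod; lia.
have hj : (c %% n.+1 < n.+1)%N by rewrite ltn_mod.
move: hi hj r_eq c_eq.
move: (r %/ n.-1)%N (r %% n.-1)%N (c %/ n.+1)%N (c %% n.+1)%N => a i b j.
move=> hi hj _ c_eq; rewrite /band.
case: eqP => [ba|ba].
  have -> : (c - a * n.+1 = j)%N by rewrite c_eq ba addKn.
  have hj' : (j < 1 + n)%N by lia.
  rewrite (ent_ord _ hi hj') mxE; case: splitP => /= j' jE.
    have j0 : j = 0%N by have := ltn_ord j'; lia.
    by rewrite mxE j0.
  have hj2 := ltn_ord j'; rewrite mxE jE /= !add1n ifT //; lia.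
case: eqP => [ba1|ba1].
  have -> : (c - a * n.+1 = n.+1 + j)%N by rewrite c_eq ba1 mulSn; lia.
  have hj' : (j < n + 1)%N by lia.
  rewrite (ent_ord _ hi hj') mxE; case: splitP => /= j' jE.
    rewrite mxE jE; have hj2 := ltn_ord j'.
    rewrite ifF; last by lia.
    rewrite ifT; last by lia.
    by rewrite /entp /= add2n; congr ent; lia.
  rewrite mxE; rewrite !ifF //; lia.
have [ab|ba2] := ltnP a.+1 b.
  have : (a.+2 * n.+1 <= b * n.+1)%N by rewrite leq_mul2r ab orbT.
  by rewrite !mulSn => le_c; rewrite !ifF //; lia.
have lt_ba : (b < a)%N by lia.
have : (b.+1 * n.+1 <= a * n.+1)%N by rewrite leq_mul2r lt_ba orbT.
by rewrite mulSn => le_c; rewrite !ifF //; lia.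
Qed.

Lemma CG_submxE (A : comNzRingType) (X : 'M[A]_n) (a : CG_index n)
    (p q : 'I_(CG_ord a).+1) :
  CG_submx X a p q =
  entp X (place (CG_kind_of a) (row_end (CG_kind_of a) - (CG_ord a).+1 + p)
                               (col_end (CG_kind_of a) - (CG_ord a).+1 + q)).
Proof.
have la := ord_lt_chain a; have := chain_length_le (CG_kind_of a).
have hp := ltn_ord p; have hq := ltn_ord q.
have NE : (k * n.+1 = N + k.*2)%N
  by rewrite /CG_N -muln2 -mulnDr; congr muln; lia.
have kn : (k.*2 <= n.+1)%N by rewrite CG_k_half; case: ifP.
rewrite /CG_submx; case: (CG_kind_of a) la => /= la _; rewrite mxE -/k -/N.
- by rewrite /entp /=; congr ent; lia.
- by rewrite -CG_U_ent; [congr ent| rewrite -/(CG_N n)| rewrite mulSn]; lia.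
- have ltMN := CG_M_le.
  by rewrite -CG_U_ent; [congr ent| rewrite -/(CG_N n)| rewrite mulSn]; lia.
Qed.

Lemma ThetaVneq K : K = Theta \/ K <> Theta.
Proof. by case: K; [left|right|right]. Qed.

Lemma band_square i x : (i < n.-1)%N -> (0 < x <= n.*2)%N -> in_square n (band i x).
Proof. by rewrite /in_square /band => hi hx; boundary_cases. Qed.

Lemma diag_band i x : (i.+1 < n.-1)%N -> (0 < x < n.*2)%N ->
  diag n (band i x) = band i.+1 x.+1.
Proof.
rewrite /band => hi hx; boundary_cases => //; rewrite /diag /=.
all: by boundary_cases; congr pair; lia.
Qed.

(** The last row of a block row of [U(X, X)] is continued, in the next block
    row, by the first row of [X]. *)
Lemma diag_band_wrap x : (n.+1 < x < n.*2)%N ->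
  diag n (band n.-2 x) = band 0 (x - n).
Proof.
rewrite /band => hx; boundary_cases; rewrite /diag /=.
by boundary_cases; congr pair; lia.
Qed.

Definition shift (K : CG_kind) : nat := if K is Psi then k.*2.+1 else k.*2.

(** The offset of the diagonal inside the block row [a] decreases by 2 from one
    block row to the next, since a block is 2 columns wider than high. *)
Lemma chain_band K a i m : K <> Theta -> (i < n.-1)%N ->
  (m.+1 + (a * n.-1 + i) = N)%N -> chain K m = band i (i + shift K - a.*2).
Proof.
move=> K_U hi mN.
have kE : (k * n.+1 = N + k.*2)%N by rewrite /CG_N -muln2 -mulnDr; congr muln; lia.
have aE : (a * n.+1 = a * n.-1 + a.*2)%N by rewrite -muln2 -mulnDr; congr muln; lia.
have rE : (N - m.+1 = a * n.-1 + i)%N by rewrite -mN addKn.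
have -> : chain K m = band ((N - m.+1) %% n.-1)
    (col_end K - m.+1 - ((N - m.+1) %/ n.-1) * n.+1).
  by case: K K_U.
rewrite rE modnMDl modn_small // divnMDl ?divn_small; [|lia..].
have cE : (col_end K = N + shift K)%N by case: K K_U => //= _; lia.
congr band; rewrite addn0 aE cE -mN.
by move: (a * n.-1)%N => Z; lia.
Qed.

Lemma row_split m : (m < N)%N -> exists a i,
  [/\ (a < k)%N, (i < n.-1)%N & (m.+1 + (a * n.-1 + i) = N)%N].
Proof.
move=> mN; exists ((N - m.+1) %/ n.-1)%N, ((N - m.+1) %% n.-1)%N.
split; [rewrite ltn_divLR -/N; lia | rewrite ltn_mod; lia |].
by rewrite -divn_eq; lia.
Qed.

(** For [n] odd the diagonal of the [psi] minors is cut before the topmost block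
    row, where it would run through [x_nn]. *)
Lemma row_split_Psi m a i : (m < CG_M n)%N -> (i < n.-1)%N ->
  (m.+1 + (a * n.-1 + i) = N)%N -> odd n -> (0 < a)%N.
Proof.
rewrite /CG_M => + hi + odd_n; rewrite odd_n.
have : (2 * n.-1 <= N)%N.
  by rewrite leq_mul2r; have := CG_k_half; rewrite odd_n; lia.
by case: a => //; lia.
Qed.

Lemma chain_square K m : (m < chain_length K)%N -> in_square n (chain K m).
Proof.
move=> mK; have [KE|K_U] := ThetaVneq K.
  by subst K; rewrite /chain /in_square /= in mK *; lia.
have [a [i [ak hi mN]]] : exists a i, [/\ (a < k)%N, (i < n.-1)%N &
    (m.+1 + (a * n.-1 + i) = N)%N].
  by apply: row_split; have := chain_length_le K; case: K mK K_U => //= *; lia.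
rewrite (chain_band K_U hi mN) band_square //.
by have := CG_k_half; rewrite /shift; case: ifP; case: (K); lia.
Qed.

Lemma chain_diag K m : (m.+1 < chain_length K)%N ->
  diag n (chain K m.+1) = chain K m.
Proof.
move=> mK; have [KE|K_U] := ThetaVneq K.
  subst K; rewrite /chain /diag /= in mK *.
  by case: ifP => ? //=; [congr pair|]; lia.
have mN : (m.+1 < N)%N by have := chain_length_le K; case: K mK K_U => //= *; lia.
have [a [i [ak hi maN]]] := row_split mN.
have sK : (k.*2 <= shift K <= k.*2.+1)%N by case: (K) => /=; lia.
have kn := CG_k_half.
rewrite (chain_band K_U hi maN).
have [i_last|i_lt] := eqVneq i n.-2; last first.
  have hi1 : (i.+1 < n.-1)%N by lia.
  rewrite diag_band //; last by case: ifP kn; lia.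
  by rewrite (chain_band K_U hi1 (a := a)); [congr band; lia | lia].
have next : (m.+1 + (a.+1 * n.-1 + 0) = N)%N by rewrite mulSn; lia.
have a1k : (a.+1 < k)%N.
  have : (a.+1 * n.-1 < k * n.-1)%N by rewrite -/N; lia.
  by rewrite ltn_mul2r => /andP[].
have n1 : (0 < n.-1)%N by lia.
rewrite (chain_band K_U n1 next) i_last diag_band_wrap; first by congr band; lia.
have : K = Psi -> odd n -> (0 < a)%N.
  by move=> KE; rewrite KE in mK; exact: row_split_Psi mK hi maN.
clear - hn a1k kn sK; case: K sK => /= sK; case: ifP kn => on kn a0;
  try have := a0 erefl isT; lia.
Qed.

Lemma chain0 K : chain K 0 =
  match K with Theta => (n, n) | Phi => (n.-1, n) | Psi => (n, 1%N) end.
Proof.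
have [->|K_U] := ThetaVneq K; first by rewrite /chain /=; congr pair; lia.
have hi : (n.-2 < n.-1)%N by lia.
have k0 : (0 < k)%N by rewrite /CG_k; lia.
have kN : (1 + (k.-1 * n.-1 + n.-2) = N)%N.
  by rewrite /CG_N -{2}(prednK k0) mulSn; lia.
rewrite (chain_band K_U hi kN) /band /shift; case: K K_U => //= _.
  by rewrite ifT; [congr pair; lia | lia].
by rewrite ifF; [rewrite ifT; [congr pair|]|]; lia.
Qed.

Lemma diag_chain0 K : diag n (chain K 0) = (0, 0)%N.
Proof.
rewrite chain0; case: K; rewrite /diag /=; boundary_cases; done.
Qed.

Lemma chain_length_gt0 K : (0 < chain_length K)%N.
Proof.
have := CG_k_half; rewrite /CG_M; case: K => /=; first by lia.
  by case: ifP => ? ?; rewrite muln_gt0; lia.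
rewrite /CG_M; case: ifP => [|_] ?; rewrite ?addn_gt0 ?orbT //.
by rewrite muln_gt0; lia.
Qed.

(** The depth of a place is the number of steps [diag] that lead to the end of
    the diagonal, and the three ends are distinct. *)
Lemma chain_inj K m K' m' : (m < chain_length K)%N -> (m' < chain_length K')%N ->
  chain K m = chain K' m' -> K = K' /\ m = m'.
Proof.
have sq0 : ~~ in_square n (0, 0)%N by [].
elim: m m' => [|m IHm] [|m'] mK mK' eq_mm'.
- split=> //; move: eq_mm'; rewrite !chain0.
  by case: K {mK}; case: K' {mK'} => // -[]; lia.
- case/negP: sq0; rewrite -(diag_chain0 K) eq_mm' chain_diag //.
  by apply: chain_square; lia.
- case/negP: sq0; rewrite -(diag_chain0 K') -eq_mm' chain_diag //.
  by apply: chain_square; lia.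
have eq' : chain K m = chain K' m'.
  by rewrite -[LHS]chain_diag // -[RHS]chain_diag // eq_mm'.
by have [-> ->] := IHm m' (ltnW mK) (ltnW mK') eq'.
Qed.

Lemma diag_not_corner p : in_square n p -> ~~ in_corner n (diag n p).
Proof.
case: p => i j; rewrite /in_square /in_corner /diag /= => hp.
by boundary_cases; rewrite !xpair_eqE; lia.
Qed.

Lemma CG_index_inj (a b : CG_index n) :
  CG_kind_of a = CG_kind_of b -> CG_ord a = CG_ord b -> a = b.
Proof.
by case: a => [[i|i]|i]; case: b => [[j|j]|j] //= _ /ord_inj->.
Qed.

Lemma CG_index_ex K m : (m < chain_length K)%N ->
  exists a : CG_index n, CG_kind_of a = K /\ CG_ord a = m.
Proof.
case: K => /= mK.
- by exists (inl (inl (Ordinal mK))).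
- by exists (inl (inr (Ordinal mK))).
- by exists (inr (Ordinal mK)).
Qed.

Lemma CG_stable_indexE (a : CG_index n) :
  CG_stable_index a = ((CG_ord a).+1 == chain_length (CG_kind_of a)).
Proof. by case: a => [[i|i]|i]. Qed.

Lemma pos_inj : injective pos.
Proof.
move=> a b /(chain_inj (ord_lt_chain a) (ord_lt_chain b))[].
exact: CG_index_inj.
Qed.

Lemma pos_square a : in_square n (pos a).
Proof. exact/chain_square/ord_lt_chain. Qed.

Lemma card_CG_index : #|CG_index n| = (n * n)%N.
Proof.
rewrite !card_sum !card_ord; have := CG_k_half; rewrite /CG_M /CG_N.
case: ifP => odd_n kE; move: (k) kE => k'.
  move=> kE; have -> : n = k'.-1.*2.+1 by lia.
  case: k' kE => [|k'] kE; first by lia.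
  by rewrite /= -!muln2; nia.
by move=> <-; case: k' => [|k'] //; rewrite -!muln2; nia.
Qed.

(** The vertices and the functions of the initial seed are equally many. *)
Lemma pos_surj p : in_square n p -> exists a, pos a = p.
Proof.
move=> /vertex_ex[v <-].
have vertexP (a : CG_index n) : exists v' : V, vplace v' == pos a.
  by have [v' <-] := vertex_ex (pos_square a); exists v'.
pose f a := xchoose (vertexP a).
have fE a : vplace (f a) = pos a := eqP (xchooseP (vertexP a)).
have f_inj : injective f by move=> a b fab; apply: pos_inj; rewrite -!fE fab.
have [|g _ gK] := inj_card_bij f_inj.
  by rewrite card_CG_index card_prod card_ord.
by exists (g v); rewrite -fE gK.
Qed.

Lemma diag_pos a : diag n (pos a) =
  if CG_ord a is m.+1 then chain (CG_kind_of a) m else (0, 0)%N.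
Proof.
rewrite /pos; case: (CG_ord a) (ord_lt_chain a) => [_|m]; first exact: diag_chain0.
exact: chain_diag.
Qed.

(** The corner of a mutable function continues the diagonal of the next larger
    minor, whereas no diagonal step leads into [in_corner]. *)
Lemma nonstable_not_corner a : ~~ CG_stable_index a -> ~~ in_corner n (pos a).
Proof.
rewrite CG_stable_indexE => aS; have la := ord_lt_chain a.
have lt_chain : ((CG_ord a).+1 < chain_length (CG_kind_of a))%N by lia.
by rewrite /pos -(chain_diag lt_chain) diag_not_corner // chain_square.
Qed.

(** The right inverse of [diff]: it sums [wt] over the diagonal of the minor
    attached to a vertex. *)
Definition potential (wt : nat * nat -> int) : 'M[int]_n :=
  \matrix_(i, j) if [pick a | pos a == (i.+1, j.+1)] is Some a
    then \sum_(m < (CG_ord a).+1) wt (chain (CG_kind_of a) m) else 0.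

Lemma potentialE wt a :
  entp (potential wt) (pos a) = \sum_(m < (CG_ord a).+1) wt (chain (CG_kind_of a) m).
Proof.
have [v va] := vertex_ex (pos_square a).
rewrite -va ent_vplace mxE -[(_, _)]/(vplace v) va.
by case: pickP => [b /eqP/pos_inj-> //|/(_ a)]; rewrite eqxx.
Qed.

Lemma diff_potential wt p : in_square n p -> diff (potential wt) p = wt p.
Proof.
move=> /pos_surj[a <-]; rewrite /diff diag_pos potentialE big_ord_recr /= addrC.
have la := ord_lt_chain a; rewrite /pos.
case aE: (CG_ord a) la => [|m] la; first by rewrite big_ord0 ent_out // subr0 addr0.
have [b [bK bm]] : exists b : CG_index n, CG_kind_of b = CG_kind_of a /\ CG_ord b = m.
  by apply: CG_index_ex; lia.
have -> : chain (CG_kind_of a) m = pos b by rewrite /pos bK bm.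
by rewrite potentialE bK bm addrK.
Qed.

Lemma diff_eq0 (A : nzRingType) (M : 'M[A]_n) :
  (forall p, in_square n p -> diff M p = 0) -> M = 0.
Proof.
move=> M0; suff chain0 K m : (m < chain_length K)%N -> entp M (chain K m) = 0.
  apply/matrixP => i j; rewrite mxE -(ent_vplace M (i, j)).
  have [a <-] := pos_surj (in_square_vplace (i, j)).
  exact/chain0/ord_lt_chain.
elim: m => [|m IHm] mK; have /eqP := M0 _ (chain_square mK); rewrite /diff.
  by rewrite diag_chain0 (@ent_out _ _ M (0, 0)%N) // subr0 => /eqP.
by rewrite chain_diag // IHm ?subr0 => [/eqP|]; last exact: ltnW.
Qed.

(** The equation at [(i, j)] with [i, j > 1] splits [g] as a function of [i] plus
    a function of [j]; the equations in the first row and in the first column,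
    where the steps wrap around, make both of them affine. *)
Lemma affine_difference_eq0 (g : nat * nat -> rat) :
  (forall p, in_square n p -> ~~ in_corner n p ->
     g (up n p) + g (left n p) = g p + g (back n p)) ->
  g (1, 1)%N = 0 -> g (1, 2)%N = 0 -> g (2, 1)%N = 0 ->
  forall p, in_square n p -> g p = 0.
Proof.
move=> gE g11 g12 g21.
have inner i j : (1 < i <= n)%N -> (1 < j <= n)%N ->
    g (i.-1, j) + g (i, j.-1) = g (i, j) + g (i.-1, j.-1).
  move=> hi hj; have := gE (i, j); rewrite /up /left /back /=.
  rewrite !ifF; [|lia..]; apply; rewrite /in_square /in_corner ?xpair_eqE /=; lia.
have split i j : (0 < i <= n)%N -> (0 < j <= n)%N ->
    g (i, j) = g (i, 1%N) + g (1%N, j).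
  elim: i j => // i IHi j hi; elim: j => // j IHj hj.
  have [i0|i0] := posnP i; first by rewrite i0 g11 add0r.
  have [j0|j0] := posnP j; first by rewrite j0 g11 addr0.
  have hi' : (0 < i <= n)%N by lia.
  have hj' : (0 < j <= n)%N by lia.
  have i1 : (1 < i.+1 <= n)%N by lia.
  have j1 : (1 < j.+1 <= n)%N by lia.
  have := inner _ _ i1 j1; rewrite /= (IHi _ hi' hj) (IHi _ hi' hj') (IHj hj').
  lra.
have row j : (j.+2 <= n)%N -> g (1%N, j.+1) = 0 /\ g (1%N, j.+2) = 0.
  elim: j => [//|j IHj] hj; have [g1 g2] := IHj (ltnW hj); split=> //.
  have := gE (1%N, j.+2); rewrite /up /left /back /= split; [|lia..].
  rewrite [g (n, j.+2)]split; [|lia..]; rewrite g1 g2 => gn.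
  have : g (n, 1%N) + g (1%N, j.+3) + 0 = 0 + (g (n, 1%N) + 0).
    by apply: gn; rewrite /in_square /in_corner ?xpair_eqE /=; lia.
  lra.
have col i : (i.+2 <= n)%N -> g (i.+1, 1%N) = 0 /\ g (i.+2, 1%N) = 0.
  elim: i => [//|i IHi] hi; have [g1 g2] := IHi (ltnW hi); split=> //.
  have := gE (i.+3, 1%N); rewrite /up /left /back /=.
  rewrite [g (i.+2, n)]split; [|lia..]; rewrite [g (i.+1, n)]split; [|lia..].
  rewrite g1 g2 => gn.
  have : 0 + (0 + g (1%N, n)) = g (i.+3, 1%N) + (0 + g (1%N, n)).
    by apply: gn; rewrite /in_square /in_corner ?xpair_eqE /=; lia.
  lra.
have row0 j : (0 < j <= n)%N -> g (1%N, j) = 0.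
  case: j => [|[|j]] // hj.
  by have [] := row j; [lia|].
have col0 i : (0 < i <= n)%N -> g (i, 1%N) = 0.
  case: i => [|[|i]] // hi.
  by have [] := col i; [lia|].
by move=> [i j] /andP[/= hi hj]; rewrite split // row0 // col0 // addr0.
Qed.

End MinorPlaces.

(** * Lowest terms of determinants *)

Section LowestTerm.
Variable F : fieldType.
Implicit Types (P Q : {poly F}) (c : F) (e : nat).

Definition lowest_term P e c := exists Q, P = 'X^e * (c%:P + 'X * Q).

Lemma lowest_term1 : lowest_term 1 0 1.
Proof. by exists 0; rewrite mulr0 addr0 mul1r. Qed.

Lemma lowest_termM P1 e1 c1 P2 e2 c2 :
  lowest_term P1 e1 c1 -> lowest_term P2 e2 c2 ->
  lowest_term (P1 * P2) (e1 + e2) (c1 * c2).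
Proof.
move=> [Q1 ->] [Q2 ->]; exists (Q1 * c2%:P + c1%:P * Q2 + 'X * Q1 * Q2).
rewrite exprD polyCM; ring.
Qed.

Lemma lowest_term_prod (I : finType) (P : I -> {poly F}) (e : I -> nat)
    (c : I -> F) (k : I -> nat) :
  (forall i, lowest_term (P i) (e i) (c i)) ->
  lowest_term (\prod_i P i ^+ k i) (\sum_i e i * k i)%N (\prod_i c i ^+ k i).
Proof.
move=> Pi; elim/big_rec3: _ => [|i x d y _ IH]; first exact: lowest_term1.
apply: lowest_termM => //; elim: (k i) => [|m IHm].
  by rewrite muln0; exact: lowest_term1.
by rewrite !exprS mulnS; exact: lowest_termM.
Qed.

Lemma lowest_termZ a P e c : lowest_term P e c -> lowest_term (a *: P) e (a * c).
Proof.
move=> [Q ->]; exists (a *: Q).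
by rewrite scalerAr scalerDr scalerAr polyCM mul_polyC.
Qed.

Lemma lowest_term_coef P e c : lowest_term P e c ->
  P`_e = c /\ forall i, (i < e)%N -> P`_i = 0.
Proof.
move=> [Q ->]; split=> [|i ie]; rewrite coefXnM; last by rewrite ie.
by rewrite ltnn subnn coefD coefC coefXM addr0.
Qed.

Lemma lowest_term_neq0 P e c : lowest_term P e c -> c != 0 -> P != 0.
Proof.
by move=> /lowest_term_coef[Pe _]; apply: contraNneq => P0; rewrite -Pe P0 coef0.
Qed.

Lemma lowest_term_inj P e c e' c' : lowest_term P e c -> lowest_term P e' c' ->
  c != 0 -> c' != 0 -> c = c'.
Proof.
move=> /lowest_term_coef[Pe P0] /lowest_term_coef[Pe' P0'] c0 c0'.
have [lt_e|lt_e'|ee'] := ltngtP e e'.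
- by rewrite -Pe P0' ?eqxx in c0.
- by rewrite -Pe' P0 ?eqxx in c0'.
- by rewrite -Pe -Pe' ee'.
Qed.

End LowestTerm.

Section MongeMinors.
Variables (m : nat) (ok : rel 'I_m) (h : 'I_m -> 'I_m -> nat).

(* The Monge condition, on the possibly nonzero entries only. *)
Hypothesis uncross : forall i i' j j' : 'I_m, (i < i')%N -> (j < j')%N ->
  ok i j' -> ok i' j ->
  [/\ ok i j, ok i' j' & (h i j + h i' j' < h i j' + h i' j)%N].
Hypothesis ok_diag : forall i, ok i i.

Lemma increasing_ge (f : 'I_m -> 'I_m) :
  (forall i j : 'I_m, (i < j)%N -> (f i < f j)%N) -> forall i : 'I_m, (i <= f i)%N.
Proof.
move=> f_incr [i hi]; elim: i hi => [//|i IHi] hi /=.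
exact: leq_ltn_trans (IHi (ltnW hi)) (f_incr (Ordinal (ltnW hi)) (Ordinal hi) (ltnSn i)).
Qed.

Lemma perm_inversion (s : 'S_m) : s != 1%g ->
  exists i j : 'I_m, (i < j)%N /\ (s j < s i)%N.
Proof.
move=> s1; suff /existsP[i /existsP[j /andP[]]] :
    [exists i : 'I_m, exists j : 'I_m, (i < j)%N && (s j < s i)%N].
  by exists i, j.
apply: contraNT s1 => /existsPn noinv.
have s_incr (i j : 'I_m) : (i < j)%N -> (s i < s j)%N.
  move=> ij; have /existsPn/(_ j) := noinv i.
  rewrite negb_and ij /= -leqNgt leq_eqVlt => /orP[/eqP/val_inj/perm_inj eij|//].
  by rewrite eij ltnn in ij.
have sV_incr (i j : 'I_m) : (i < j)%N -> (s^-1%g i < s^-1%g j)%N.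
  move=> ij; have [//||/val_inj/perm_inj eij] := ltngtP (s^-1%g i) (s^-1%g j).
    by move=> /s_incr; rewrite !permKV ltnNge ltnW.
  by rewrite eij ltnn in ij.
apply/eqP/perm.permP => i; rewrite perm1; apply/val_inj/eqP.
rewrite eqn_leq (increasing_ge s_incr) andbT.
by rewrite -{2}(permK s i) (increasing_ge sV_incr).
Qed.

Definition cost (s : 'S_m) : nat := \sum_i h i (s i).

Lemma uncross_perm (s : 'S_m) : s != 1%g -> (forall i, ok i (s i)) ->
  exists2 s' : 'S_m, (forall i, ok i (s' i)) & (cost s' < cost s)%N.
Proof.
move=> /perm_inversion[i [j [ij sji]]] s_ok.
have [ok_i ok_j lt_h] := uncross ij sji (s_ok i) (s_ok j).
have ji : j != i by rewrite neq_ltn ij orbT.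
exists (tperm i j * s)%g => [l|].
  by rewrite permM; case: tpermP => [->|->|_ _].
rewrite /cost [ltnLHS](bigD1 i) //= [ltnRHS](bigD1 i) //=.
rewrite [X in (_ + X < _)%N](bigD1 j) //= [X in (_ < _ + X)%N](bigD1 j) //=.
rewrite !permM tpermL tpermR !addnA.
have -> : \sum_(l | (l != i) && (l != j)) h l ((tperm i j * s)%g l) =
          \sum_(l | (l != i) && (l != j)) h l (s l).
  by apply: eq_bigr => l /andP[li lj]; rewrite permM tpermD // eq_sym.
by rewrite ltn_add2r.
Qed.

Lemma cost_gt_diag (s : 'S_m) : s != 1%g -> (forall i, ok i (s i)) ->
  (\sum_i h i i < cost s)%N.
Proof.
move=> s1 s_ok; pose P (t : 'S_m) := [forall i, ok i (t i)].
have P1 : P 1%g by apply/forallP => i; rewrite perm1.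
case: (arg_minnP cost P1) => t /forallP t_ok t_min.
have t1 : t = 1%g.
  apply/eqP; apply/negPn/negP => /uncross_perm/(_ t_ok)[t' t'_ok].
  by rewrite ltnNge t_min //; exact/forallP.
have [s' s'_ok] := uncross_perm s1 s_ok; apply: leq_ltn_trans.
rewrite (leq_trans _ (t_min s' _)) //; last exact/forallP.
by rewrite t1 /cost; apply: leq_sum => i _; rewrite perm1.
Qed.

(** Every permutation other than the identity has an inversion, which can be
    undone at a lower cost; so the identity is the only cheapest permutation
    among those that avoid the zero entries. *)
Lemma det_lowest_term (F : fieldType) (y : 'I_m -> 'I_m -> F) :
  lowest_term (\det (\matrix_(i, j) if ok i j then (y i j)%:P * 'X^(h i j) else 0))
    (\sum_i h i i) (\prod_i y i i).
Proof.
rewrite /determinant (bigD1 1%g) //= odd_perm1 expr0 mul1r.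
under eq_bigr do rewrite mxE perm1 ok_diag.
rewrite big_split /= -rmorph_prod prodrXr.
set S := (X in lowest_term (_ + X)).
suff [Q ->] : exists Q, S = 'X^(\sum_i h i i) * ('X * Q).
  by exists Q; rewrite mulrDr; congr (_ + _); rewrite mulrC.
rewrite {}/S; elim/big_ind: _ => [|P1 P2 [Q1 ->] [Q2 ->]|s s1].
- by exists 0; rewrite !mulr0.
- by exists (Q1 + Q2); rewrite !mulrDr.
have [/forallP s_ok|/forallPn[i s_i]] := boolP [forall i, ok i (s i)]; last first.
  by exists 0; rewrite (bigD1 i) //= mxE (negbTE s_i) mul0r !mulr0.
under eq_bigr do rewrite mxE s_ok.
rewrite big_split /= prodrXr; have lt_cost := cost_gt_diag s1 s_ok.
rewrite /cost in lt_cost; rewrite -(subnKC lt_cost) exprD exprSr.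
exists ((-1) ^+ s * (\prod_i (y i (s i))%:P) * 'X^(\sum_i h i (s i) - (\sum_i h i i).+1)).
move: ((-1) ^+ s) (\prod_i _) ('X^(_ - _)) ('X^(\sum_i h i i)) => sg Y Z T.
by ring.
Qed.

End MongeMinors.

(** * Weights and lowest terms of the initial minors *)

Section Minors.
Variable n : nat.
Hypothesis hn : (2 <= n)%N.

Lemma place_chain (a : CG_index n) (p : 'I_(CG_ord a).+1) :
  place n (CG_kind_of a) (row_end n (CG_kind_of a) - (CG_ord a).+1 + p)
                         (col_end n (CG_kind_of a) - (CG_ord a).+1 + p) =
  chain n (CG_kind_of a) (CG_ord a - p).
Proof.
have lp := ltn_ord p; have la := ord_lt_chain a.
have lr := chain_length_le hn (CG_kind_of a).
have rc : (row_end n (CG_kind_of a) <= col_end n (CG_kind_of a))%N.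
  by case: (CG_kind_of a) => //=; rewrite /CG_N; [|apply: leqW]; rewrite leq_mul2l; lia.
by rewrite /chain; congr place; lia.
Qed.

Lemma big_chain (T : Type) (idx : T) (op : Monoid.com_law idx)
    (a : CG_index n) (f : nat * nat -> T) :
  \big[op/idx]_(p < (CG_ord a).+1) f (chain n (CG_kind_of a) (CG_ord a - p)) =
  \big[op/idx]_(m < (CG_ord a).+1) f (chain n (CG_kind_of a) m).
Proof.
rewrite (reindex_inj rev_ord_inj) /=; apply: eq_bigr => m _.
by rewrite subSS subKn // -ltnS.
Qed.

Lemma chain_square_sub (a : CG_index n) p :
  in_square n (chain n (CG_kind_of a) (CG_ord a - p)).
Proof.
by apply: chain_square => //; apply: leq_ltn_trans (ord_lt_chain a); exact: leq_subr.
Qed.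

Lemma CG_fun_map (A B : comNzRingType) (f : {rmorphism A -> B}) (X : 'M[A]_n) a :
  f (CG_fun X a) = CG_fun (map_mx f X) a.
Proof.
rewrite -det_map_mx; congr (\det _); apply/matrixP => p q.
rewrite [LHS]mxE !CG_submxE //; set pl := place _ _ _ _.
have [/vertex_ex[v <-]|pl_out] := boolP (in_square n pl).
  by rewrite !ent_vplace mxE.
by rewrite !ent_out // rmorph0.
Qed.

Section Weights.
Variables (A : comUnitRingType) (t0 t1 t2 : A).
Hypotheses (u1 : t1 \is a GRing.unit) (u2 : t2 \is a GRing.unit).

Definition monomial_weight (p : nat * nat) : A := t0 * t1 ^+ p.1 * t2 ^+ p.2.

Definition row_weight K r : A :=
  if K is Theta then t0 * t1 ^+ r.+1
  else t0 * t1 ^+ (r %% n.-1).+1 * (t1 * t2) ^- (r %/ n.-1).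

Definition col_weight K c : A :=
  if K is Theta then t2 ^+ c.+1
  else (t1 * t2) ^+ (c %/ n.+1) * t2 ^+ (c %% n.+1).

(** From a block to its right neighbour, the entries of [X] move up by one row
    and left by one column: the weight of the entry at a fixed position in the
    block grows by [t1 * t2], which the factors of the blocks account for. *)
Lemma place_weight K r c : in_square n (place n K r c) ->
  monomial_weight (place n K r c) = row_weight K r * col_weight K c.
Proof.
have [->|K_U] := ThetaVneq K; first by [].
have -> : place n K r c = band n (r %% n.-1) (c - (r %/ n.-1) * n.+1).
  by case: K K_U.
have -> : row_weight K r =
    t0 * t1 ^+ (r %% n.-1).+1 * (t1 * t2) ^- (r %/ n.-1) by case: K K_U.
have -> : col_weight K c = (t1 * t2) ^+ (c %/ n.+1) * t2 ^+ (c %% n.+1).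
  by case: K K_U.
have hi : (r %% n.-1 < n.-1)%N by rewrite ltn_mod; lia.
have u12 : t1 * t2 \is a GRing.unit by rewrite unitrM u1.
move: hi (r %/ n.-1)%N; move: (r %% n.-1)%N => i hi a hp.
set x := (c - a * n.+1)%N in hp *.
have x0 : (0 < x <= n.*2)%N.
  by move: hp; rewrite /band /in_square; boundary_cases.
have cE : (c = a * n.+1 + x)%N by rewrite /x; lia.
rewrite cE divnMDl // modnMDl.
have [xn|xn] := leqP x n.
  rewrite divn_small // modn_small // addn0 /band ifT; last by lia.
  by rewrite /monomial_weight /= [RHS]mulrA divrK ?unitrX.
have xE : (x = 1 * n.+1 + (x - n.+1))%N by lia.
rewrite [in RHS]xE divnMDl // modnMDl divn_small; last by lia.
rewrite modn_small; last by lia.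
rewrite /band ifF; last by lia.
rewrite ifT; last by lia.
rewrite /monomial_weight /= addn0 addn1 [(t1 * t2) ^+ a.+1]exprSr.
rewrite -[_ * t2 ^+ _ in RHS]mulrA.
rewrite [RHS]mulrA divrK ?unitrX //.
by rewrite (_ : x - n = (x - n.+1).+1)%N; [rewrite !exprS; ring|lia].
Qed.

(** The scaling of the entries amounts to a scaling of the rows and of the
    columns by [place_weight], so all the terms of the determinant are
    multiplied by the same factor as the diagonal. *)
Lemma CG_fun_weight (X X' : 'M[A]_n) (a : CG_index n) :
  (forall v : 'I_n * 'I_n,
     X' v.1 v.2 = monomial_weight (vplace v) * X v.1 v.2) ->
  CG_fun X' a =
  (\prod_(m < (CG_ord a).+1) monomial_weight (chain n (CG_kind_of a) m)) * CG_fun X a.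
Proof.
move=> X'E; rewrite /CG_fun; set K := CG_kind_of a.
pose r0 := (row_end n K - (CG_ord a).+1)%N.
pose c0 := (col_end n K - (CG_ord a).+1)%N.
pose R := \row_(p < (CG_ord a).+1) row_weight K (r0 + p).
pose C := \row_(p < (CG_ord a).+1) col_weight K (c0 + p).
have -> : CG_submx X' a = diag_mx R *m CG_submx X a *m diag_mx C.
  apply/matrixP => p q; rewrite mul_mx_diag mxE mul_diag_mx mxE !CG_submxE //.
  rewrite -/K -/r0 -/c0 !mxE.
  have [sq|out] := boolP (in_square n (place n K (r0 + p) (c0 + q))); last first.
    by rewrite !ent_out // mulr0 mul0r.
  rewrite mulrAC -place_weight //; have [v <-] := vertex_ex sq.
  by rewrite !ent_vplace X'E.
rewrite !det_mulmx !det_diag mulrAC -big_split /=; congr (_ * _).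
under eq_bigr => p _ do
  rewrite !mxE -place_weight place_chain ?chain_square_sub //.
exact: big_chain.
Qed.

End Weights.

(** The mixed term makes the cost Monge inside of one copy of [X]. The concave
    term in the row and the convex term in the column are there for the pairs
    of entries in two different copies of [X]: their second differences
    [2 * n] exceed those of the mixed term, which are less than [n]. *)
Definition cost_at (p : nat * nat) : nat :=
  (n * (p.1 * (n.*2 - p.1)) + n * p.2 ^ 2 + p.1 * (n - p.2))%N.

Lemma cost_atZ p : in_square n p -> (cost_at p)%:Z =
  n%:Z * p.1%:Z * (2 * n%:Z - p.1%:Z) + n%:Z * p.2%:Z ^+ 2
    + p.1%:Z * (n%:Z - p.2%:Z).
Proof.
case: p => i j; rewrite /in_square /cost_at /= => hp.
rewrite !PoszD !PoszM -!subzn; [|lia..].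
by rewrite -muln2 PoszM expr2; ring.
Qed.

Lemma band_ge1 i x : in_square n (band n i x) -> (0 < x <= n.*2)%N.
Proof. by rewrite /band /in_square; boundary_cases. Qed.

Lemma bandY i x : (0 < x <= n)%N -> band n i x = (i.+1, x).
Proof. by rewrite /band => ->. Qed.

Lemma bandX i x : (n < x <= n.*2)%N -> band n i x = (i.+2, (x - n)%N).
Proof. by rewrite /band => hx; rewrite ifF ?hx //; lia. Qed.

Lemma cost_at_lt p p' q q' (x y : int) :
  0 < x -> 0 < y ->
  (cost_at q)%:Z + (cost_at q')%:Z =
    (cost_at p)%:Z + (cost_at p')%:Z + x * y ->
  (cost_at p + cost_at p' < cost_at q + cost_at q')%N.
Proof. by move=> x0 y0 E; have := mulr_gt0 x0 y0; lia. Qed.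

(** Two rows of the same block row. *)
Lemma band_uncross i i' x x' : (i < i' < n.-1)%N -> (0 < x)%N -> (x < x' <= n.*2)%N ->
  (cost_at (band n i x) + cost_at (band n i' x') <
   cost_at (band n i x') + cost_at (band n i' x))%N.
Proof.
move=> hi x0 hx.
have sq j z : (j < n.-1)%N -> (0 < z <= n.*2)%N -> in_square n (band n j z).
  exact: band_square.
have sq1 : in_square n (band n i x) by apply: sq; lia.
have sq2 : in_square n (band n i' x') by apply: sq; lia.
have sq3 : in_square n (band n i x') by apply: sq; lia.
have sq4 : in_square n (band n i' x) by apply: sq; lia.
have [x'n|x'n] := leqP x' n.
  apply: (@cost_at_lt _ _ _ _ (i'%:Z - i%:Z) (x'%:Z - x%:Z)) => //; [lia|lia|].
  by rewrite !cost_atZ // !bandY /=; [ring|lia..].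
have [xn|xn] := leqP x n.
  apply: (@cost_at_lt _ _ _ _ (i'%:Z - i%:Z) (n%:Z + x'%:Z - x%:Z)) => //; [lia|lia|].
  have xr : (0 < x <= n)%N by rewrite x0.
  have x'r : (n < x' <= n.*2)%N by lia.
  by rewrite !cost_atZ // !(bandY _ xr) !(bandX _ x'r) /= -subzn; [ring|lia].
apply: (@cost_at_lt _ _ _ _ (i'%:Z - i%:Z) (x'%:Z - x%:Z)) => //; [lia|lia|].
have xr : (n < x <= n.*2)%N by lia.
have x'r : (n < x' <= n.*2)%N by lia.
by rewrite !cost_atZ // !(bandX _ xr) !(bandX _ x'r) /= -!subzn; [ring|lia..].
Qed.

(** Two rows of consecutive block rows, which share one block of columns. *)
Lemma band_uncross_next i i' y y' : (i < n.-1)%N -> (i' < n.-1)%N ->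
  (0 < y < y')%N -> (y' < n)%N ->
  (cost_at (band n i (n.+1 + y)) + cost_at (band n i' y') <
   cost_at (band n i (n.+1 + y')) + cost_at (band n i' y))%N.
Proof.
move=> hi hi' hy y'n.
have sq j z : (j < n.-1)%N -> (0 < z <= n.*2)%N -> in_square n (band n j z).
  exact: band_square.
have sq1 : in_square n (band n i (n.+1 + y)) by apply: sq; lia.
have sq2 : in_square n (band n i' y') by apply: sq; lia.
have sq3 : in_square n (band n i (n.+1 + y')) by apply: sq; lia.
have sq4 : in_square n (band n i' y) by apply: sq; lia.
apply: (@cost_at_lt _ _ _ _ (y'%:Z - y%:Z) (2 * n%:Z + i'%:Z - i%:Z - 1)) => //; [lia|lia|].
have yr : (0 < y <= n)%N by lia.
have y'r : (0 < y' <= n)%N by lia.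
have zr : (n < n.+1 + y <= n.*2)%N by lia.
have z'r : (n < n.+1 + y' <= n.*2)%N by lia.
rewrite !cost_atZ // !(bandY _ yr) !(bandY _ y'r) !(bandX _ zr) !(bandX _ z'r) /=.
by rewrite -!subzn; [ring|lia..].
Qed.

(** The entries of [X] in a row of [U(X, X)] form an interval shorter than two
    blocks, whose ends never move to the left from one row to the next. So the
    uncrossed entries belong to [X] too, and the two rows lie in the same block
    row or in consecutive ones. *)
Lemma place_uncross K r r' c c' : (r < r')%N -> (c < c')%N ->
  in_square n (place n K r c') -> in_square n (place n K r' c) ->
  [/\ in_square n (place n K r c), in_square n (place n K r' c') &
      (cost_at (place n K r c) + cost_at (place n K r' c') <
       cost_at (place n K r c') + cost_at (place n K r' c))%N].
Proof.
move=> rr' cc'; have [->|K_U] := ThetaVneq K.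
  move=> sq1 sq2; have sq3 : in_square n (place n Theta r c).
    by rewrite /in_square /= in sq1 sq2 *; lia.
  have sq4 : in_square n (place n Theta r' c').
    by rewrite /in_square /= in sq1 sq2 *; lia.
  split=> //; apply: (@cost_at_lt _ _ _ _ (r'%:Z - r%:Z) (c'%:Z - c%:Z)) => //; [lia|lia|].
  by rewrite !cost_atZ //=; ring.
have placeE u w : place n K u w = band n (u %% n.-1) (w - (u %/ n.-1) * n.+1).
  by case: K K_U.
have hi : (r %% n.-1 < n.-1)%N by rewrite ltn_mod; lia.
have hi' : (r' %% n.-1 < n.-1)%N by rewrite ltn_mod; lia.
rewrite !placeE; have rE := divn_eq r n.-1; have r'E := divn_eq r' n.-1.
move: rr' hi hi'; rewrite {1}rE {1}r'E {rE r'E}.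
move: (r %/ n.-1)%N (r %% n.-1)%N (r' %/ n.-1)%N (r' %% n.-1)%N => a i a' i'.
move=> rr' hi hi' sq1 sq2.
have x1 := band_ge1 sq1; have x2 := band_ge1 sq2.
have [aa'|a'a|eaa'] := ltngtP a a'; last first.
- subst a'; split; [apply: band_square => //; lia..|].
  by apply: band_uncross; lia.
- have : (a'.+1 * n.-1 <= a * n.-1)%N by rewrite leq_mul2r a'a orbT.
  by rewrite mulSn; lia.
have [aa2|a'E] : (a.+2 <= a')%N \/ a' = a.+1 by lia.
  have : (a.+2 * n.+1 <= a' * n.+1)%N by rewrite leq_mul2r aa2 orbT.
  by rewrite !mulSn; lia.
rewrite a'E in x2 *; rewrite mulSn in x2 *.
have xE : (c - a * n.+1 = n.+1 + (c - (n.+1 + a * n.+1)))%N by lia.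
have x'E : (c' - a * n.+1 = n.+1 + (c' - (n.+1 + a * n.+1)))%N by lia.
split; [apply: band_square => //; lia..|].
by rewrite xE x'E; apply: band_uncross_next => //; lia.
Qed.

Lemma CG_fun_lowest_term (F : fieldType) (y : nat * nat -> F) (Y : 'M[{poly F}]_n)
    (a : CG_index n) :
  (forall v : 'I_n * 'I_n,
     Y v.1 v.2 = (y (vplace v))%:P * 'X^(cost_at (vplace v))) ->
  lowest_term (CG_fun Y a)
    (\sum_(m < (CG_ord a).+1) cost_at (chain n (CG_kind_of a) m))%N
    (\prod_(m < (CG_ord a).+1) y (chain n (CG_kind_of a) m)).
Proof.
move=> YE; set K := CG_kind_of a.
pose r0 := (row_end n K - (CG_ord a).+1)%N.
pose c0 := (col_end n K - (CG_ord a).+1)%N.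
pose pl (p q : 'I_(CG_ord a).+1) := place n K (r0 + p) (c0 + q).
have -> : CG_fun Y a = \det (\matrix_(p, q) if in_square n (pl p q)
    then (y (pl p q))%:P * 'X^(cost_at (pl p q)) else 0).
  congr (\det _); apply/matrixP => p q; rewrite CG_submxE // mxE -/K -/r0 -/c0.
  case: ifPn => [sq|out]; last by rewrite ent_out.
  by rewrite /pl -[place _ _ _ _]/(pl p q) in sq *;
     have [v <-] := vertex_ex sq; rewrite ent_vplace YE.
rewrite -!(big_chain _ a) -/K.
have -> : \prod_(p < (CG_ord a).+1) y (chain n K (CG_ord a - p)) = \prod_p y (pl p p).
  by apply: eq_bigr => p _; rewrite /pl place_chain.
have -> : (\sum_(p < (CG_ord a).+1) cost_at (chain n K (CG_ord a - p)) =
    \sum_p cost_at (pl p p))%N.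
  by apply: eq_bigr => p _; rewrite /pl place_chain.
apply: (det_lowest_term (ok := fun p q => in_square n (pl p q))
  (h := fun p q => cost_at (pl p q)) _ _ (fun p q => y (pl p q))) => [p p' q q' pp' qq'|p].
  by apply: place_uncross; rewrite ltn_add2l.
by rewrite /pl place_chain; exact: chain_square_sub.
Qed.

End Minors.

(** * Substitutions in rational functions *)

Section Fractions.
Variable A : idomainType.

Lemma fraction_repr (f : {fraction A}) :
  f = FracField.tofrac (frac (repr f)).1 / FracField.tofrac (frac (repr f)).2.
Proof.
have d0 : FracField.tofrac (frac (repr f)).2 != 0 by rewrite tofrac_eq0 denom_ratioP.
apply: (mulIf d0); rewrite divfK //; set x := repr f.
have -> : f = \pi_({fraction A})%qT x by rewrite reprK.
unlock FracField.tofrac; rewrite -[LHS]FracField.pi_mul.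
apply/eqmodP; rewrite /= FracField.equivfE /FracField.mulf /=.
rewrite !numden_Ratio ?mulf_neq0 ?oner_eq0 ?denom_ratioP //.
by apply/eqP; ring.
Qed.

Local Notation toF := (@FracField.tofrac A).

Lemma fractionP (f : {fraction A}) : exists p q, q != 0 /\ f = toF p / toF q.
Proof.
by exists (frac (repr f)).1, (frac (repr f)).2; rewrite denom_ratioP -fraction_repr.
Qed.

Lemma eq_fraction (p q p' q' : A) : q != 0 -> q' != 0 ->
  (toF p / toF q == toF p' / toF q') = (p * q' == p' * q).
Proof. by move=> q0 q'0; rewrite eqr_div ?tofrac_eq0 // -!tofracM tofrac_eq. Qed.

Lemma sub_fraction (p q p' q' : A) : q != 0 -> q' != 0 ->
  toF p / toF q - toF p' / toF q' = toF (p * q' - p' * q) / toF (q * q').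
Proof.
move=> q0 q'0; rewrite -mulNr addf_div ?tofrac_eq0 // mulNr.
by rewrite tofracB !tofracM.
Qed.

Lemma mul_fraction (p q p' q' : A) :
  (toF p / toF q) * (toF p' / toF q') = toF (p * p') / toF (q * q').
Proof. by rewrite mulf_div !tofracM. Qed.

(** For an injective morphism [phi] the value does not depend on the fraction
    that represents [f], and this is the extension of [phi] to the field. *)
Definition fraction_map (phi : A -> A) (f : {fraction A}) : {fraction A} :=
  toF (phi (frac (repr f)).1) / toF (phi (frac (repr f)).2).

Section InjectiveMorphism.
Variable phi : {rmorphism A -> A}.
Hypothesis phi_inj : injective phi.

Lemma inj_morph_neq0 a : a != 0 -> phi a != 0.
Proof. by rewrite -(inj_eq phi_inj) rmorph0. Qed.

Lemma fraction_map_div p q : q != 0 ->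
  fraction_map phi (toF p / toF q) = toF (phi p) / toF (phi q).
Proof.
move=> q0; rewrite /fraction_map; set f := toF p / toF q.
have d0 : (frac (repr f)).2 != 0 by exact: denom_ratioP.
have /eqP := fraction_repr f; rewrite {1}/f eq_fraction // => /eqP eq_f.
by apply/eqP; rewrite eq_fraction ?inj_morph_neq0 // -!rmorphM eq_f.
Qed.

Lemma fraction_map_tofrac p : fraction_map phi (toF p) = toF (phi p).
Proof.
have := fraction_map_div p (oner_neq0 A).
by rewrite !rmorph1 !divr1.
Qed.

Lemma fraction_map_zmod : zmod_morphism (fraction_map phi).
Proof.
move=> f g; have [p [q [q0 ->]]] := fractionP f; have [p' [q' [q'0 ->]]] := fractionP g.
rewrite sub_fraction // !fraction_map_div ?mulf_neq0 //.
by rewrite sub_fraction ?inj_morph_neq0 // rmorphB !rmorphM.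
Qed.

Lemma fraction_map_monoid : monoid_morphism (fraction_map phi).
Proof.
split=> [|f g]; first by rewrite -(rmorph1 toF) fraction_map_tofrac !rmorph1.
have [p [q [q0 ->]]] := fractionP f; have [p' [q' [q'0 ->]]] := fractionP g.
by rewrite mul_fraction !fraction_map_div ?mulf_neq0 // mul_fraction !rmorphM.
Qed.

End InjectiveMorphism.

Lemma fraction_map_comp (phi1 phi2 phi : {rmorphism A -> A}) f :
  injective phi1 -> injective phi2 -> (forall a, phi1 (phi2 a) = phi a) ->
  fraction_map phi f = fraction_map phi1 (fraction_map phi2 f).
Proof.
move=> inj1 inj2 comp12; have inj12 : injective phi.
  by move=> a b; rewrite -!comp12 => /inj1/inj2.
have [p [q [q0 ->]]] := fractionP f.
by rewrite !fraction_map_div ?inj_morph_neq0 // !comp12.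
Qed.

Lemma fraction_map_id (phi : {rmorphism A -> A}) f :
  (forall a, phi a = a) -> fraction_map phi f = f.
Proof.
by move=> phi1; rewrite /fraction_map !phi1 -fraction_repr.
Qed.

End Fractions.

Section Scaling.
Variables (F : fieldType) (m : nat).
Implicit Types (s : 'I_m -> F).

Definition scaling s : m.-tuple {mpoly F[m]} := [tuple s i *: 'X_i | i < m].

Lemma scaling_monomial s e :
  comp_mpoly (scaling s) 'X_[e] = (\prod_i s i ^+ e i) *: 'X_[e].
Proof.
rewrite comp_mpolyX [in RHS]mpolyXE_id -scaler_prod.
by apply: eq_bigr => i _; rewrite tnth_mktuple exprZn.
Qed.

Lemma scaling_comp s s' p :
  comp_mpoly (scaling s) (comp_mpoly (scaling s') p) =
  comp_mpoly (scaling (fun i => s i * s' i)) p.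
Proof.
elim/mpolyind: p => [|c e p _ _ IHp]; first by rewrite !raddf0.
rewrite !raddfD /= IHp; congr (_ + _).
rewrite !comp_mpolyZ !scaling_monomial comp_mpolyZ scaling_monomial.
congr (c *: _); rewrite scalerA -big_split /=; congr (_ *: _).
by apply: eq_bigr => i _; rewrite exprMn mulrC.
Qed.

Lemma scaling1 s p : (forall i, s i = 1) -> comp_mpoly (scaling s) p = p.
Proof.
move=> s1; rewrite -[RHS]comp_mpoly_id; congr comp_mpoly.
by apply: eq_from_tnth => i; rewrite !tnth_mktuple s1 scale1r.
Qed.

Lemma scaling_inj s : (forall i, s i != 0) -> injective (comp_mpoly (scaling s)).
Proof.
move=> s0; apply: (can_inj (g := comp_mpoly (scaling (fun i => (s i)^-1)))) => p.
by rewrite scaling_comp scaling1 // => i; rewrite mulVf.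
Qed.

End Scaling.

(** * The initial cluster and its stable variables *)

Section InitialCluster.
Variables (R : realType) (n : nat).
Hypothesis hn : (2 <= n)%N.
Local Notation C := R[i].
Local Notation CG_poly := {mpoly C[(n * n)%N]}.
Local Notation K := (CG_field R n).
Local Notation V := ('I_n * 'I_n)%type.
Local Notation toK := (@FracField.tofrac CG_poly).
Local Notation G := (generic_mx R n).

Definition CG_iota : {rmorphism C -> K} := toK \o @mpolyC (n * n) C.

Lemma mxvec_index_inj (v w : V) :
  mxvec_index v.1 v.2 = mxvec_index w.1 w.2 -> v = w.
Proof.
move=> /(congr1 (mxvec (\matrix_(i, j) ((i, j) : V)) 0)).
by rewrite !mxvecE !mxE -!surjective_pairing.
Qed.

Lemma generic_mx_inj (v w : V) : G v.1 v.2 = G w.1 w.2 -> v = w.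
Proof.
rewrite !mxE => /(congr1 (mcoeff U_(mxvec_index v.1 v.2))).
rewrite !mcoeffXU eqxx; case: eqP => [/mxvec_index_inj-> //|_ /eqP].
by rewrite oner_eq0.
Qed.

Lemma attachedE (a : CG_index n) (v : V) :
  attached R a v = (pos a == vplace v).
Proof.
rewrite /attached /CG_corner CG_submxE // !addn0 -[place _ _ _ _]/(pos a).
have [w wa] := vertex_ex (pos_square hn a).
rewrite -wa ent_vplace (inj_eq (@vplace_inj n)).
by apply/eqP/eqP => [/generic_mx_inj|->].
Qed.

Lemma CG_clusterE (a : CG_index n) (v : V) : pos a = vplace v ->
  CG_cluster R v = toK (CG_fun G a).
Proof.
move=> av; rewrite /CG_cluster; case: pickP => [b|/(_ a)]; last first.
  by rewrite attachedE av eqxx.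
by rewrite attachedE -av => /eqP/(pos_inj hn)->.
Qed.

Lemma stable_corner (v : V) : in_corner n (vplace v) -> v \in CG_stable R n.
Proof.
move=> vC; have [a av] := pos_surj hn (in_square_vplace v).
rewrite inE; apply/existsP; exists a; rewrite attachedE av eqxx andbT.
by apply: contraTT vC; rewrite -av; exact: nonstable_not_corner.
Qed.

Lemma card_corner : #|[set v : V | in_corner n (vplace v)]| = 3.
Proof.
have [v1 v1E] := @vertex_ex n (1, 1)%N ltac:(rewrite /in_square /=; lia).
have [v2 v2E] := @vertex_ex n (1, n)%N ltac:(rewrite /in_square /=; lia).
have [v3 v3E] := @vertex_ex n (2, 1)%N ltac:(rewrite /in_square /=; lia).
have -> : [set v : V | in_corner n (vplace v)] = [set v1; v2; v3].
  apply/setP => v; rewrite !inE -!(inj_eq (@vplace_inj n)) v1E v2E v3E.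
  by rewrite /in_corner orbA.
rewrite setUC cardsU1 cards2 !inE -!(inj_eq (@vplace_inj n)) v1E v2E v3E !xpair_eqE.
lia.
Qed.

(** There is one stable function of each kind, the last one. *)
Lemma card_stable : #|CG_stable R n| = 3.
Proof.
have vertexP (a : CG_index n) : exists v : V, vplace v == pos a.
  by have [v <-] := vertex_ex (pos_square hn a); exists v.
pose f a := xchoose (vertexP a).
have fE a : vplace (f a) = pos a := eqP (xchooseP (vertexP a)).
have f_inj : injective f by move=> a b fab; apply: (pos_inj hn); rewrite -!fE fab.
have -> : CG_stable R n = [set f a | a in [pred a | CG_stable_index a]].
  apply/setP => v; rewrite inE; apply/existsP/imsetP => [[a /andP[aS]]|[a aS ->]].
    rewrite attachedE => /eqP av; exists a; rewrite // ?inE //.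
    by apply: (@vplace_inj n); rewrite fE av.
  by exists a; rewrite attachedE fE eqxx andbT; rewrite inE in aS.
rewrite card_imset //.
have last K : ((chain_length n K).-1 < chain_length n K)%N.
  by rewrite prednK // chain_length_gt0.
have [x [xK xm]] := CG_index_ex (last Theta).
have [y [yK ym]] := CG_index_ex (last Phi).
have [z [zK zm]] := CG_index_ex (last Psi).
have -> : #|[pred a : CG_index n | CG_stable_index a]| = #|[set x; y; z]|.
  apply: eq_card => a; rewrite !inE CG_stable_indexE.
  have L K : ((CG_ord a).+1 == chain_length n K) = (CG_ord a == (chain_length n K).-1).
    by have := chain_length_gt0 hn K; lia.
  rewrite L; apply/eqP/idP => [am|].
    case aK: (CG_kind_of a) am => am.
    - by rewrite (_ : a = x) ?eqxx //; apply: CG_index_inj; rewrite ?aK ?am.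
    - by rewrite (_ : a = y) ?eqxx ?orbT //; apply: CG_index_inj; rewrite ?aK ?am.
    - by rewrite (_ : a = z) ?eqxx ?orbT //; apply: CG_index_inj; rewrite ?aK ?am.
  by case/orP => [/orP[]|] /eqP->; rewrite ?xK ?yK ?zK.
have neqK (a b : CG_index n) : CG_kind_of a <> CG_kind_of b -> (a == b) = false.
  by move=> ab; apply/eqP => eab; case: ab; rewrite eab.
rewrite setUC cardsU1 cards2 !inE !neqK ?xK ?yK ?zK //.
Qed.

(** The corners are stable, and there are as many stable vertices as corners. *)
Lemma CG_stableE (v : V) : (v \in CG_stable R n) = in_corner n (vplace v).
Proof.
have /eqP <- : [set v : V | in_corner n (vplace v)] == CG_stable R n.
  rewrite eqEcard card_stable card_corner leqnn andbT.
  by apply/subsetP => w; rewrite inE; exact: stable_corner.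
by rewrite inE.
Qed.

(** * Independence of the exchange monomials *)

Lemma index_ex (v : V) : exists a : CG_index n, pos a == vplace v.
Proof. by have [a av] := pos_surj hn (in_square_vplace v); exists a; apply/eqP. Qed.

Definition index_at (v : V) : CG_index n := xchoose (index_ex v).

Lemma index_atE v : pos (index_at v) = vplace v.
Proof. exact/eqP/(xchooseP (index_ex v)). Qed.

Definition vertex_fun (v : V) : CG_poly := CG_fun G (index_at v).

Lemma cluster_vertex_fun v : CG_cluster R v = toK (vertex_fun v).
Proof. exact/CG_clusterE/index_atE. Qed.

(** The substitution for which the lowest term of a minor is the product of the
    values [y] over its diagonal. *)
Definition one_parameter (y : nat * nat -> C) : {rmorphism CG_poly -> {poly C}} :=
  mmap (@polyC C) (mxvec (\matrix_(i < n, j < n)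
    ((y (i.+1, j.+1))%:P * 'X^(cost_at n (i.+1, j.+1)))) 0).

Definition vertex_cost (v : V) : nat :=
  \sum_(m < (CG_ord (index_at v)).+1)
    cost_at n (chain n (CG_kind_of (index_at v)) m).

Definition vertex_value (y : nat * nat -> C) (v : V) : C :=
  \prod_(m < (CG_ord (index_at v)).+1) y (chain n (CG_kind_of (index_at v)) m).

Lemma vertex_fun_lowest y v :
  lowest_term (one_parameter y (vertex_fun v)) (vertex_cost v) (vertex_value y v).
Proof.
rewrite CG_fun_map //; apply: CG_fun_lowest_term => // w.
by rewrite !mxE /= mmapX mmap1U mxvecE mxE.
Qed.

Definition vertex_monomial (e : V -> nat) : CG_poly := \prod_w vertex_fun w ^+ e w.

Lemma vertex_monomial_lowest y e :
  lowest_term (one_parameter y (vertex_monomial e))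
    (\sum_w vertex_cost w * e w)%N (\prod_w vertex_value y w ^+ e w).
Proof.
rewrite rmorph_prod; under eq_bigr do rewrite rmorphXn.
exact/lowest_term_prod/vertex_fun_lowest.
Qed.

Lemma vertex_fun_neq0 v : vertex_fun v != 0.
Proof.
have low := vertex_fun_lowest (fun=> 1) v.
apply: contraTneq (lowest_term_neq0 low _) => [->|]; first by rewrite rmorph0 eqxx.
by rewrite /vertex_value big1 ?oner_neq0.
Qed.

Lemma lowest_terms_proportional y e1 e2 (l1 l2 : C) :
  (forall p, y p != 0) ->
  l1 *: vertex_monomial e1 + l2 *: vertex_monomial e2 = 0 ->
  l1 * \prod_w vertex_value y w ^+ e1 w = - l2 * \prod_w vertex_value y w ^+ e2 w.
Proof.
move=> y0 rel.
have val0 e : \prod_w vertex_value y w ^+ e w != 0.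
  by apply/prodf_neq0 => w _; rewrite expf_neq0 //; apply/prodf_neq0.
have low e l := lowest_termZ l (vertex_monomial_lowest y e).
have {}rel : l1 *: one_parameter y (vertex_monomial e1) =
             (- l2) *: one_parameter y (vertex_monomial e2).
  apply/eqP; rewrite scaleNr -addr_eq0 -!mul_polyC.
  have evC (l : C) : l%:P = one_parameter y l%:MP by rewrite /= mmapC.
  by rewrite !evC -!rmorphM -rmorphD !mul_mpolyC rel rmorph0.
have [l10|l10] := eqVneq l1 0; have [l20|l20] := eqVneq l2 0.
- by rewrite l10 l20 oppr0 !mul0r.
- have : lowest_term (- l2 *: one_parameter y (vertex_monomial e2)) _ _ := low e2 (- l2).
  move=> /lowest_term_neq0; rewrite mulf_neq0 ?oppr_eq0 // -rel l10 scale0r eqxx.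
  by move/(_ isT).
- have := low e1 l1.
  move=> /lowest_term_neq0; rewrite mulf_neq0 // rel l20 oppr0 scale0r eqxx.
  by move/(_ isT).
have low1 := low e1 l1; rewrite rel in low1.
by apply: (lowest_term_inj low1 (low e2 (- l2))); rewrite mulf_neq0 ?oppr_eq0.
Qed.

(** With all [y] equal to 1 the lowest coefficients are 1, and with [y] equal to
    2 at [v] only they are powers of 2 with different exponents: the diagonals
    that occur in the two monomials do not pass equally often through [v]. No
    single ratio of the monomials is compatible with both. *)
Lemma exchange_free (v : V) (l1 l2 : C) : v \notin CG_stable R n ->
  l1 *: vertex_monomial (CG_quiver v)
    + l2 *: vertex_monomial (fun w => CG_quiver w v) = 0 ->
  l1 = 0 /\ l2 = 0.
Proof.
rewrite CG_stableE => vC rel.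
have l12 : l1 = - l2.
  have := lowest_terms_proportional (y := fun=> 1) (fun=> oner_neq0 _) rel.
  have val1 e : \prod_w vertex_value (fun=> 1) w ^+ e w = 1.
    by rewrite big1 // => w _; rewrite /vertex_value big1 // expr1n.
  by rewrite !val1 !mulr1.
pose y (p : nat * nat) : C := 2%:R ^+ (p == vplace v).
have y0 p : y p != 0 by rewrite expf_neq0 // pnatr_eq0.
pose wt (p : nat * nat) : int := (p == vplace v)%:Z.
pose N w := (\sum_(m < (CG_ord (index_at w)).+1)
  (chain n (CG_kind_of (index_at w)) m == vplace v))%N.
have NE w : (N w)%:Z = potential n wt w.1 w.2.
  rewrite -ent_vplace -index_atE potentialE // /N.
  by rewrite (big_morph Posz PoszD (erefl _)).
have valE e : \prod_w vertex_value y w ^+ e w = 2%:R ^+ (\sum_w N w * e w)%N.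
  rewrite -prodrXr; apply: eq_bigr => w _.
  by rewrite /vertex_value /y prodrXr -exprM.
have := lowest_terms_proportional y0 rel; rewrite !valE l12.
set N1 := (\sum_w _)%N; set N2 := (\sum_w _)%N => eq12.
have N12 : N1 <> N2.
  have := quiver_defect hn (potential n wt) vC.
  have sq := in_square_vplace v.
  rewrite !diff_potential ?up_square ?left_square ?back_square // /wt.
  have /and3P[/negbTE-> /negbTE-> /negbTE->] := neighbours_neq hn sq vC.
  rewrite eqxx => defect.
  have N1E : N1%:Z = \sum_w potential n wt w.1 w.2 *+ CG_quiver v w.
    rewrite (big_morph Posz PoszD (erefl _)).
    by apply: eq_bigr => w _; rewrite -NE PoszM -mulr_natr natz.
  have N2E : N2%:Z = \sum_w potential n wt w.1 w.2 *+ CG_quiver w v.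
    rewrite (big_morph Posz PoszD (erefl _)).
    by apply: eq_bigr => w _; rewrite -NE PoszM -mulr_natr natz.
  by move=> e12; move: defect; rewrite -N1E -N2E e12; lia.
suff l20 : l2 = 0 by rewrite l20 oppr0.
apply/eqP; apply: contra_notT N12 => l20.
have /eqP : (2%:R ^+ N1 : C) = 2%:R ^+ N2 by apply: (@mulfI _ (- l2)); rewrite ?oppr_eq0.
by rewrite -!natrX eqr_nat eqn_exp2l // => /eqP.
Qed.

(** * Weights of global toric actions *)

Lemma character_inj s (w1 w2 : 'I_s -> int) :
  (forall d : 'rV[C]_s, torus d -> character d w1 = character d w2) -> w1 =1 w2.
Proof.
move=> eq12 a; pose d : 'rV[C]_s := \row_b (if b == a then 2%:R else 1).
have td : torus d by move=> b; rewrite mxE; case: ifP; rewrite ?pnatr_eq0 ?oner_eq0.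
have dE w : character d w = 2%:R ^ w a.
  rewrite /character (bigD1 a) //= mxE eqxx big1 ?mulr1 // => b /negbTE ba.
  by rewrite mxE ba exp1rz.
have two0 : (2%:R : C) != 0 by rewrite pnatr_eq0.
have : (2%:R : C) ^ (w1 a - w2 a) = 1.
  by rewrite expfzDr // -dE eq12 // dE -expfzDr // subrr expr0z.
have pow1 m : (2%:R : C) ^+ m = 1 -> m = 0%N.
  move=> /eqP; rewrite -natrX -[1]/(1%:R) eqr_nat -[1%N](expn0 2) eqn_exp2l //.
  by move=> /eqP.
case wE: (w1 a - w2 a) => [k|k].
  by rewrite -exprnP => /pow1 k0; move: wE; rewrite k0; lia.
by rewrite NegzE -exprnN => /(congr1 GRing.inv); rewrite invrK invr1 => /pow1.
Qed.

Lemma exchange_scaling (L : fieldType) (m1 m2 x a1 a2 b c : L) :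
  x != 0 -> b != 0 -> (m1 * a1 + m2 * a2) / (x * b) = (m1 + m2) / x * c ->
  m1 * (a1 - c * b) + m2 * (a2 - c * b) = 0.
Proof.
move=> x0 b0 /(congr1 ( *%R^~ (x * b))).
rewrite /= divfK ?mulf_neq0 // mulrACA divfK // => E.
by rewrite !mulrBr addrACA E -opprD -mulrDl subrr.
Qed.

(** Both monomials of an exchange relation must be scaled by the same factor
    as soon as their sum is scaled, because they are not proportional. *)
Lemma global_action_balanced s (act : 'rV[C]_s -> K -> K) W :
  global_toric_action CG_iota (CG_stable R n) (CG_seed R n) act ->
  (forall d, torus d -> forall v,
    act d (CG_cluster R v) = CG_cluster R v * CG_iota (character d (W v))) ->
  balanced (CG_stable R n) (@CG_quiver n) W.
Proof.
move=> [Hact glob] homW v vS; apply: character_inj => d td.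
have [W' [_ homW']] := glob _ (mutated_seed (initial_seed _ _) vS).
have [g gE] := torus_field_action_rmorphism Hact td.
have gx w : g (CG_cluster R w) = CG_cluster R w * CG_iota (character d (W w)).
  by rewrite -gE homW.
have := homW' d td v; rewrite gE /= /mutate_cluster eqxx.
have monE e : \prod_w CG_cluster R w ^+ e w = toK (vertex_monomial e).
  rewrite rmorph_prod; apply: eq_bigr => w _.
  by rewrite rmorphXn cluster_vertex_fun.
have xv0 : CG_cluster R v != 0.
  by rewrite cluster_vertex_fun tofrac_eq0 vertex_fun_neq0.
rewrite fmorph_div rmorphD !(quasi_homogeneous_monomial td _ gx) !monE.
rewrite gx -/(character d (W' v)).
set c1 := character d _; set c2 := character d _; set cv := character d (W v).
set c' := character d (W' v); rewrite -/CG_iota => exch.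
have cv0 : CG_iota cv != 0 by rewrite fmorph_eq0 character_neq0.
have {}exch : toK (vertex_monomial (CG_quiver v)) * CG_iota (c1 - c' * cv) +
    toK (vertex_monomial (fun w => CG_quiver w v)) * CG_iota (c2 - c' * cv) = 0.
  have iotaBM a : CG_iota (a - c' * cv) = CG_iota a - CG_iota c' * CG_iota cv.
    by rewrite [LHS]rmorphB [X in _ - X]rmorphM.
  rewrite !iotaBM; apply: (exchange_scaling xv0 cv0); exact: exch.
have [] := exchange_free vS (l1 := c1 - c' * cv) (l2 := c2 - c' * cv).
  apply/eqP; rewrite -tofrac_eq0 -!mul_mpolyC rmorphD !rmorphM /=.
  by rewrite mulrC [X in _ + X]mulrC; apply/eqP.
by move=> /eqP; rewrite subr_eq0 => /eqP-> /eqP; rewrite subr_eq0 => /eqP->.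
Qed.

(** More than three weights would have a nontrivial combination whose
    difference along the diagonals vanishes at three places that determine an
    affine function, hence everywhere. *)
Lemma balanced_rank_le3 s (W : V -> 'I_s -> int) :
  \rank (weight_mx W) = s -> balanced (CG_stable R n) (@CG_quiver n) W -> (s <= 3)%N.
Proof.
move=> /weight_rankP W_inj bal; rewrite leqNgt; apply/negP => s3.
pose M a : 'M[int]_n := \matrix_(i, j) W (i, j) a.
pose corner (m : 'I_3) : nat * nat := nth (0, 0)%N [:: (1, 1); (1, 2); (2, 1)]%N m.
pose B : 'M[rat]_(s, 3) := \matrix_(a, m) (diff (M a) (corner m))%:~R.
have kerB : kermx B != 0.
  rewrite -mxrank_eq0 mxrank_ker subn_eq0 -ltnNge.
  exact: leq_ltn_trans (rank_leq_col B) s3.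
have /rowV0Pn[u /sub_kermxP uB u0] := kerB.
pose c a := u 0 a.
have gB m : \sum_a (diff (M a) (corner m))%:~R * c a = 0.
  have /rowP/(_ m) := uB; rewrite !mxE => uBm; rewrite -[RHS]uBm.
  by apply: eq_bigr => a _; rewrite mxE mulrC.
have diff0 p : in_square n p -> \sum_a (diff (M a) p)%:~R * c a = 0.
  apply: (affine_difference_eq0 hn (g := fun p => \sum_a (diff (M a) p)%:~R * c a)).
  - move=> _ /vertex_ex[v <-] vC; rewrite -!big_split; apply: eq_bigr => a _ /=.
    have := quiver_defect hn (M a) vC.
    have vS : v \notin CG_stable R n by rewrite CG_stableE.
    have sumE (q : V -> nat) :
        \sum_w M a w.1 w.2 *+ q w = \sum_w W w a *+ q w.
      by apply: eq_bigr => w _; rewrite mxE -surjective_pairing.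
    rewrite !sumE bal // subrr => /esym/eqP.
    rewrite -addrA -opprD subr_eq0 => /eqP E.
    by rewrite -!mulrDl -!rmorphD /= E.
  - exact: (gB 0).
  - exact: (gB 1).
  - exact: (gB 2).
have Mc0 : \matrix_(i, j) \sum_a (M a i j)%:~R * c a = 0.
  by apply: (diff_eq0 hn) => p sq; rewrite diff_lincomb diff0.
case/eqP: u0; apply/rowP => a; rewrite mxE.
apply: (W_inj c) => v; have /matrixP/(_ v.1 v.2) := Mc0; rewrite !mxE => Wv0.
by rewrite -[RHS]Wv0; apply: eq_bigr => b _; rewrite mxE -surjective_pairing.
Qed.

(** * The action on [X] by scalars and by powers of [D_n] *)

Definition action_weight (t : 'rV[C]_3) (p : nat * nat) : C :=
  monomial_weight (t 0 0) (t 0 1) (t 0 2%:R) p.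

Definition action_scale (t : 'rV[C]_3) : 'I_(n * n) -> C :=
  mxvec (\matrix_(i < n, j < n) action_weight t (i.+1, j.+1)) 0.

Lemma scaled_powD_entry (A : comUnitRingType) (t0 t1 t2 : A) (X : 'M[A]_n) i j :
  (t0 *: (powD n t1 *m X *m powD n t2)) i j =
  monomial_weight t0 t1 t2 (i.+1, j.+1) * X i j.
Proof.
rewrite mxE mul_mx_diag mxE mul_diag_mx !mxE /monomial_weight /=; ring.
Qed.

Lemma monomial_weight_morph (A B : comUnitRingType) (f : {rmorphism A -> B}) t0 t1 t2 p :
  f (monomial_weight t0 t1 t2 p) = monomial_weight (f t0) (f t1) (f t2) p.
Proof. by rewrite /monomial_weight !rmorphM !rmorphXn. Qed.

Lemma CG_action_map t f :
  CG_action t f = fraction_map (comp_mpoly (scaling (action_scale t))) f.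
Proof.
rewrite -[RHS]/(pullback _ f) /CG_action; congr (pullback _ f).
apply: eq_from_tnth => p; rewrite [LHS]tnth_mktuple [RHS]tnth_mktuple.
case/mxvec_indexP: p => i j; rewrite [LHS]mxvecE /action_scale mxvecE.
rewrite scaled_powD_entry [in RHS]mxE -mul_mpolyC [G i j]mxE.
by rewrite -monomial_weight_morph.
Qed.

Lemma action_scale_neq0 t p : torus t -> action_scale t p != 0.
Proof.
move=> tt; case/mxvec_indexP: p => i j; rewrite /action_scale mxvecE mxE.
by rewrite /action_weight !mulf_neq0 ?expf_neq0.
Qed.

Lemma action_scale1 p : action_scale (const_mx 1) p = 1.
Proof.
case/mxvec_indexP: p => i j; rewrite /action_scale mxvecE mxE.
by rewrite /action_weight /monomial_weight !mxE !expr1n !mulr1.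
Qed.

Lemma action_scaleM (d e : 'rV[C]_3) p :
  action_scale (\row_a (d 0 a * e 0 a)) p = action_scale d p * action_scale e p.
Proof.
case/mxvec_indexP: p => i j; rewrite /action_scale !mxvecE !mxE.
by rewrite /action_weight /monomial_weight !mxE !exprMn; ring.
Qed.

Lemma CG_field_action : torus_field_action CG_iota (@CG_action R n).
Proof.
have inj d : torus d -> injective (comp_mpoly (scaling (action_scale d))).
  by move=> td; apply: scaling_inj => i; exact: action_scale_neq0.
split=> [d td|f|d e td te f].
- split=> [f g||c].
  + rewrite !CG_action_map; exact: (fraction_map_zmod (inj d td)).
  + have [map1 mapM] := fraction_map_monoid (inj d td).
    by split=> [|f g]; rewrite !CG_action_map.
  + by rewrite CG_action_map (fraction_map_tofrac (inj d td)) /= comp_mpolyC.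
- rewrite CG_action_map fraction_map_id // => p.
  by rewrite /= scaling1 // => i; exact: action_scale1.
rewrite !CG_action_map; apply: (fraction_map_comp f (inj d td) (inj e te)) => p.
rewrite [LHS]scaling_comp; congr (comp_mpoly _ p).
by apply: eq_from_tnth => i; rewrite !tnth_mktuple action_scaleM.
Qed.

(** The exponents of [t_0], [t_1] and [t_2] in the weight of [x_ij]. *)
Definition entry_weight (a : 'I_3) (p : nat * nat) : int :=
  nth 0 [:: 1; p.1%:Z; p.2%:Z] a.

Definition CG_weight (v : V) (a : 'I_3) : int :=
  potential n (entry_weight a) v.1 v.2.

Lemma character_entry_weight d p :
  character d (entry_weight^~ p) = action_weight d p.
Proof.
rewrite /character !big_ord_recl big_ord0 /action_weight /entry_weight /=.
rewrite expr1z mulr1 mulrA -!exprnP.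
by congr (d 0 _ * d 0 _ ^+ _ * d 0 _ ^+ _); apply: val_inj.
Qed.

(** [CG_fun_weight] for the generic matrix, pushed to the field of fractions. *)
Lemma CG_weight_action d : torus d -> forall v,
  CG_action d (CG_cluster R v) =
  CG_cluster R v * CG_iota (character d (CG_weight v)).
Proof.
move=> td v; have s0 i : action_scale d i != 0 by exact: action_scale_neq0.
rewrite cluster_vertex_fun CG_action_map (fraction_map_tofrac (scaling_inj s0)).
rewrite -[CG_iota _]/(toK _%:MP) -tofracM; congr toK.
have unitC (c : C) : c != 0 -> (c%:MP : CG_poly) \is a GRing.unit.
  by move=> c0; rewrite rmorph_unit // unitfE.
rewrite /vertex_fun [LHS]CG_fun_map //.
rewrite (CG_fun_weight hn (t0 := (d 0 0)%:MP) (unitC _ (td 1)) (unitC _ (td 2%:R))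
  (X := G)) => [|w]; last first.
  rewrite mxE [G w.1 w.2]mxE /= /comp_mpoly mmapX mmap1U tnth_mktuple /action_scale.
  by rewrite mxvecE mxE -mul_mpolyC -monomial_weight_morph.
rewrite mulrC; congr (_ * _).
have -> : character d (CG_weight v) =
    \prod_(m < (CG_ord (index_at v)).+1)
       action_weight d (chain n (CG_kind_of (index_at v)) m).
  rewrite -[RHS](eq_bigr _ (fun m _ => character_entry_weight _ _)).
  rewrite exchange_big; apply: eq_bigr => a _ /=.
  rewrite /CG_weight -ent_vplace -index_atE potentialE //.
  have expD : {morph (fun x : int => d 0 a ^ x) : x y / x + y >-> x * y}.
    by move=> x y; exact/expfzDr/td.
  exact: (big_morph _ expD (expr0z _)).
rewrite rmorph_prod; apply: eq_bigr => m _.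
by rewrite /= -monomial_weight_morph.
Qed.

Lemma diff_CG_weight a p : in_square n p ->
  diff (\matrix_(i, j) CG_weight (i, j) a) p = entry_weight a p.
Proof.
move=> sq; rewrite -(diff_potential hn (entry_weight a) sq); congr (diff _ p).
by apply/matrixP => i j; rewrite mxE.
Qed.

Lemma CG_weight_balanced : balanced (CG_stable R n) (@CG_quiver n) CG_weight.
Proof.
move=> v; rewrite CG_stableE => vC a.
have sq := in_square_vplace v.
apply/eqP; rewrite -subr_eq0.
have := quiver_defect hn (potential n (entry_weight a)) vC.
rewrite !diff_potential ?up_square ?left_square ?back_square // => ->.
have [E1 E2] := parallelogram hn sq vC; rewrite /= in E1 E2; apply/eqP.
case: a => [[|[|[|a]]] ha] //; rewrite /entry_weight /=; lia.
Qed.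

Lemma CG_weight_rank : \rank (weight_mx CG_weight) = 3.
Proof.
apply/weight_rankP => c Wc0.
have sum0 p : in_square n p -> \sum_a (entry_weight a p)%:~R * c a = 0.
  move=> sq; under eq_bigr do rewrite -diff_CG_weight //.
  rewrite -diff_lincomb; set M := \matrix_(i, j) _.
  have entM q : entp M q = 0.
    have [/vertex_ex[v <-]|/ent_out-> //] := boolP (in_square n q).
    rewrite ent_vplace mxE -[RHS](Wc0 v); apply: eq_bigr => a _.
    by rewrite mxE -surjective_pairing.
  by rewrite /diff !entM subr0.
have sq11 : in_square n (1, 1)%N by rewrite /in_square /=; lia.
have sq12 : in_square n (1, 2)%N by rewrite /in_square /=; lia.
have sq21 : in_square n (2, 1)%N by rewrite /in_square /=; lia.
have := sum0 _ sq11; have := sum0 _ sq12; have := sum0 _ sq21.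
rewrite !big_ord_recl !big_ord0 /entry_weight /= => E21 E12 E11.
have c1 : c (lift ord0 ord0) = 0 by lra.
have c2 : c (lift ord0 (lift ord0 ord0)) = 0 by lra.
have c0 : c ord0 = 0 by lra.
move=> a; case: (unliftP ord0 a) => [b ->|-> //].
case: (unliftP ord0 b) => [b' ->|-> //].
by rewrite (ord1 b').
Qed.

End InitialCluster.

Local Close Scope ring_scope.

Theorem proposition6p2 (R : realType) (n : nat) (hn : (2 <= n)%N) :
  (* the action is a global toric action of rank 3 *)
  global_toric_action (@CG_const R n) (CG_stable R n) (CG_seed R n)
    (@CG_action R n : 'rV[R[i]]_3 -> CG_field R n -> CG_field R n)
  (* and 3 is the number of stable variables and the maximal rank *)
  /\ #|CG_stable R n| = 3
  /\ forall (s : nat) (act : 'rV[R[i]]_s -> CG_field R n -> CG_field R n),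
       global_toric_action (@CG_const R n) (CG_stable R n) (CG_seed R n) act ->
       (s <= 3)%N.
Proof.
split; [|split; [exact: card_stable|move=> s act glob]].
  change (global_toric_action (CG_iota R n) (CG_stable R n) (CG_seed R n)
    (@CG_action R n)).
  apply: (balanced_global_toric_action (W := @CG_weight n)).
  - exact: CG_field_action.
  - by move=> v; exact: CG_quiver_loopless.
  - exact: CG_weight_rank.
  - exact: CG_weight_balanced.
  - exact: CG_weight_action.
have [W [rkW homW]] := (proj2 glob) _ (initial_seed _ _).
apply: (balanced_rank_le3 (R := R) hn rkW).
exact: (global_action_balanced hn glob homW).
Qed.
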